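(* Let $(W,S)$ be a Coxeter system with Davis complex $\Sigma$ and Coxeter-cell skeleta $\Sigma_n$. Let $M$ be any left Bredon module over $\mathcal{O}_{\mathfrak{Fin}(W)}W$. For each spherical $T$, let $M_T$ denote the restriction of $M$ to $W_T$, i.e. $M_T(W_T/K)=M(W/K)$ for $K\le W_T$, with the induced maps. Then for every $n\ge 0$ and every degree $i$, $$H^{\mathfrak{Fin}(W)}_i(\Sigma_n,\Sigma_{n-1};M)\;\cong\;\bigoplus_{T\in\mathcal S,\ |T|=n} H^{\mathfrak{Fin}(W_T)}_i\big(C_{W_T},\partial C_{W_T};M_T\big).$$ On the left the homology is taken with respect to the $W$-action. On the right it is taken with respect to the $W_T$-action on the Coxeter cell $C_{W_T}$ and the family of all subgroups of the finite group $W_T$. All spaces are given the $G$-CW-structure of their barycentric subdivisions.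
   Context: Bredon homology. Let $G$ be a discrete group and $\mathfrak F$ a family of subgroups closed under conjugation and passing to subgroups. The orbit category $\mathcal O_{\mathfrak F}G$ has objects $G/K$ with $K\in\mathfrak F$, and morphisms the $G$-maps. A $G$-map $R_g\colon G/K\to G/L$, $R_g(K)=gL$, exists exactly when $g^{-1}Kg\subseteq L$. A left Bredon module is a covariant functor $\mathcal O_{\mathfrak F}G\to\mathfrak{Ab}$. A $G$-CW-complex is a CW-complex with a cell-permuting $G$-action such that any element mapping a cell to itself fixes it pointwise. For a $G$-CW-complex $X$ with all stabilizers in $\mathfrak F$, choose orbit representatives $e_\alpha$ of $d$-cells with stabilizers $S_\alpha$ and set $C_d=\bigoplus_\alpha M(G/S_\alpha)$. The differential is induced by the incidence numbers of the cellular boundary: for a face $g\cdot e'$ of $e_\alpha$ one has $g^{-1}S_\alpha g\subseteq \mathrm{stab}(e')$, and the corresponding component is $M(R_g)$. Then $H^{\mathfrak F}_i(X;M)$ is the homology of this complex. For a $G$-subcomplex $A$, the relative groups $H^{\mathfrak F}_i(X,A;M)$ are the homology of the analogous complex built only on the cells of $X$ not in $A$. The result is independent of $\mathfrak F$ as long as $\mathfrak F$ contains all isotropy groups. $\mathfrak{Fin}(G)$ denotes the family of finite subgroups. Coxeter groups. A Coxeter system $(W,S)$ has $S=\{s_1,\dots,s_N\}$ finite and $W=\langle s_1,\dots,s_N\mid (s_is_j)^{m_{ij}}=1\rangle$, where $m_{ii}=1$ and $m_{ij}=m_{ji}\in\{2,3,\dots\}\cup\{\infty\}$ for $i\ne j$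 ($\infty$ means no relation). For $T\subseteq S$, the special subgroup is $W_T=\langle T\rangle$, and $(W_T,T)$ is a Coxeter system. $T$ is spherical if $W_T$ is finite, $\mathcal S$ is the set of spherical subsets (including $\varnothing$), and $\mathrm{rank}(T)=|T|$. Coxeter cells. For a finite Coxeter group $W$ with $|S|=N$, the Coxeter cell $C_W\subset\mathbb R^N$ is the convex hull of the orbit $Wx$ of a point $x$ in the interior of the fundamental chamber of the canonical reflection representation $W\to GL_N(\mathbb R)$. Its faces correspond bijectively and inclusion-preservingly to the cosets $wW_T$ ($T\subseteq S$): the face for $wW_T$ is the convex hull of $wW_Tx$, which is a copy $wC_{W_T}$ of the Coxeter cell of $W_T$. $\partial C_W$ denotes its topological boundary in $\mathbb R^N$. Davis complex. $W\mathcal S=\bigsqcup_{T\in\mathcal S}W/W_T$ is the poset of spherical cosets under inclusion, with $W$ acting by left multiplication. $\Sigma$ is its geometric realization. For $T\in\mathcal S$ and $w\in W$, the subcomplex $|(W\mathcal S)_{\le wW_T}|$ is identified with the barycentric subdivision of a copy $C_{wW_T}=wC_{W_T}$ of the Coxeter cell of $W_T$, so that $\Sigma=\bigcup_{T\in\mathcal S,\,wW_T\in W/W_T}C_{wW_T}$. For $n\ge -1$, $\Sigma_n$ is the union of the $C_{wW_T}$ with $T\in\mathcal S$ and $|T|\le n$; in particular $\Sigma_{-1}=\varnothing$. *)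

(* Defs.v *)
From HB Require Import structures.
From mathcomp Require Import all_boot all_algebra.
From Stdlib Require Import ClassicalEpsilon.
From Stdlib Require List.

Set Implicit Arguments.
Unset Strict Implicit.
Unset Printing Implicit Defensive.

Import GRing.Theory.
Local Open Scope ring_scope.

Definition is_subgroup (W : groupType) (K : W -> Prop) : Prop :=
  K 1%g /\ (forall x y, K x -> K y -> K (x * y)%g) /\ (forall x, K x -> K (x^-1)%g).

Definition pfinite (W : eqType) (K : W -> Prop) : Prop :=
  exists l : seq W, forall x, K x -> x \in l.

Definition fin_subgroup (W : groupType) (K : W -> Prop) : Prop :=
  is_subgroup K /\ pfinite K.

(* An object W/K (K a finite subgroup) is represented by K; the morphism    *)
(* R_g : W/K -> W/L, R_g(K) = gL, exists iff g^-1 K g <= L.                  *)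
(* M K is the abelian group M(W/K), and Mmap K L g is M(R_g) (its values     *)
(* for g not giving a morphism are irrelevant junk).                        *)

Definition orbit_mor (W : groupType) (K L : W -> Prop) (g : W) : Prop :=
  forall k, K k -> L (g^-1 * k * g)%g.

Definition is_fin_bredon_module (W : groupType) (M : (W -> Prop) -> zmodType)
  (Mmap : forall K L : W -> Prop, W -> M K -> M L) : Prop :=
  forall K L P : W -> Prop, fin_subgroup K -> fin_subgroup L -> fin_subgroup P ->
  [/\
      (forall g, orbit_mor K L g -> forall x y, Mmap K L g (x - y) = Mmap K L g x - Mmap K L g y),
      (* M(R_g) depends only on the morphism R_g, i.e. on the coset gL *)
      (forall g g', orbit_mor K L g -> L (g^-1 * g')%g -> forall x, Mmap K L g x = Mmap K L g' x),
      (forall x, Mmap K K 1%g x = x) &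
      (* composition: R_h o R_g = R_{gh} *)
      (forall g h, orbit_mor K L g -> orbit_mor L P h ->
         forall x, Mmap L P h (Mmap K L g x) = Mmap K P (g * h)%g x)].

(* Coxeter systems.  m i j = 0 encodes m_ij = infinity.                      *)

Definition coxeter_matrix (N : nat) (m : 'I_N -> 'I_N -> nat) : Prop :=
  forall i j, m i j = m j i /\ (m i j == 1)%N = (i == j).

Definition coxeter_rel (H : groupType) (N : nat) (m : 'I_N -> 'I_N -> nat)
  (h : 'I_N -> H) : Prop :=
  forall i j, m i j != 0%N -> ((h i * h j) ^+ m i j)%g = 1%g.

(* (W, s) is the Coxeter group with Coxeter matrix m, i.e.
   W = < s_1, ..., s_N | (s_i s_j)^{m_ij} = 1 >, stated via the universal
   property of a presentation. *)
Definition is_coxeter_system (W : groupType) (N : nat) (m : 'I_N -> 'I_N -> nat)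
  (s : 'I_N -> W) : Prop :=
  [/\ coxeter_matrix m, coxeter_rel m s &
      forall (H : groupType) (h : 'I_N -> H), coxeter_rel m h ->
        exists f : W -> H,
          ((forall x y, f (x * y)%g = (f x * f y)%g) /\ (forall i, f (s i) = h i)) /\
          (forall f' : W -> H, (forall x y, f' (x * y)%g = (f' x * f' y)%g) ->
             (forall i, f' (s i) = h i) -> forall x, f' x = f x)].

Definition special (W : groupType) (N : nat) (s : 'I_N -> W) (T : {set 'I_N}) (w : W) : Prop :=
  forall K : W -> Prop, is_subgroup K -> (forall i, i \in T -> K (s i)) -> K w.

Definition spherical (W : groupType) (N : nat) (s : 'I_N -> W) (T : {set 'I_N}) : Prop :=
  pfinite (special s T).

Definition coset (W : groupType) (N : nat) (s : 'I_N -> W) (w : W) (T : {set 'I_N}) : W -> Prop :=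
  fun x => special s T (w^-1 * x)%g.

(* Vertices of the barycentric subdivision of Sigma_n: spherical cosets
   w W_T with |T| <= n  (Sigma_n = union of the C_{wW_T}, |T| <= n). *)
Definition Sigma_skel (W : groupType) (N : nat) (s : 'I_N -> W) (n : nat)
  (X : W -> Prop) : Prop :=
  exists w T, [/\ spherical s T, (#|T| <= n)%N & X = coset s w T].

Definition Sigma_skel_prev (W : groupType) (N : nat) (s : 'I_N -> W) (n : nat)
  (X : W -> Prop) : Prop :=
  if n is n'.+1 then Sigma_skel s n' X else False.

(* Vertices of the barycentric subdivision of the Coxeter cell C_{W_T}:
   its faces, i.e. the cosets u W_U with u in W_T and U a subset of T. *)
Definition cox_cell (W : groupType) (N : nat) (s : 'I_N -> W) (T : {set 'I_N})
  (X : W -> Prop) : Prop :=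
  exists (u : W) (U : {set 'I_N}), [/\ special s T u, U \subset T & X = coset s u U].

Definition cox_cell_bd (W : groupType) (N : nat) (s : 'I_N -> W) (T : {set 'I_N})
  (X : W -> Prop) : Prop :=
  exists (u : W) (U : {set 'I_N}), [/\ special s T u, U \proper T & X = coset s u U].

(* Relative Bredon chain complex of the realization of a poset X of subsets *)
(* of W (ordered by inclusion), relative to a subposet A, for the action of *)
(* a subgroup G of W by left translation.  Cells of the barycentric          *)
(* subdivision are the strict chains sigma = [x_0 < ... < x_d].              *)

Definition lact (W : groupType) (g : W) (Y : W -> Prop) : W -> Prop :=
  fun x => Y (g^-1 * x)%g.

Definition act (W : groupType) (g : W) (sigma : seq (W -> Prop)) : seq (W -> Prop) :=
  map (lact g) sigma.

Definition strict_chain (W : Type) (sigma : seq (W -> Prop)) : Prop :=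
  forall k, (k.+1 < size sigma)%N ->
    (forall x, nth (fun _ => False) sigma k x -> nth (fun _ => False) sigma k.+1 x) /\
    (exists x, nth (fun _ => False) sigma k.+1 x /\ ~ nth (fun _ => False) sigma k x).

Definition rel_cell (W : Type) (X A : (W -> Prop) -> Prop) (d : nat)
  (sigma : seq (W -> Prop)) : Prop :=
  [/\ size sigma = d.+1, strict_chain sigma, List.Forall X sigma & ~ List.Forall A sigma].

Definition orb_rep (W : groupType) (G : W -> Prop) (sigma : seq (W -> Prop)) : seq (W -> Prop) :=
  epsilon (inhabits sigma) (fun tau => exists g, G g /\ tau = act g sigma).

Definition transporter (W : groupType) (G : W -> Prop) (sigma' tau : seq (W -> Prop)) : W :=
  epsilon (inhabits 1%g) (fun g => G g /\ sigma' = act g tau).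

Definition stab (W : groupType) (G : W -> Prop) (sigma : seq (W -> Prop)) : W -> Prop :=
  fun g => G g /\ act g sigma = sigma.

Definition chain_ty (W : groupType) (G : W -> Prop) (M : (W -> Prop) -> zmodType) : Type :=
  forall sigma : seq (W -> Prop), M (stab G sigma).

(* C_d = (+)_{alpha} M(W/S_alpha), alpha ranging over the chosen orbit
   representatives e_alpha of relative d-cells (finitely supported). *)
Definition is_chain (W : groupType) (G : W -> Prop) (X A : (W -> Prop) -> Prop)
  (M : (W -> Prop) -> zmodType) (d : nat) (c : chain_ty G M) : Prop :=
  (forall sigma, c sigma != 0 -> rel_cell X A d sigma /\ orb_rep G sigma = sigma) /\
  (exists l : seq (seq (W -> Prop)), forall sigma, c sigma != 0 -> List.In sigma l).

Definition chain_supp (W : groupType) (G : W -> Prop) (M : (W -> Prop) -> zmodType)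
  (c : chain_ty G M) : seq (seq (W -> Prop)) :=
  epsilon (inhabits [::])
    (fun l => List.NoDup l /\ forall sigma, c sigma != 0 -> List.In sigma l).

Definition face (W : Type) (j : nat) (sigma : seq (W -> Prop)) : seq (W -> Prop) :=
  take j sigma ++ drop j.+1 sigma.

Definition pif (P : Prop) (Z : zmodType) (x : Z) : Z :=
  if excluded_middle_informative P then x else 0.

(* Differential C_{d+1} -> C_d: the component from e_alpha (a (d+1)-cell) to
   e' (a d-cell) sums, over the faces g.e' of e_alpha, the signed maps M(R_g). *)
Definition bredon_bd (W : groupType) (G : W -> Prop) (X A : (W -> Prop) -> Prop)
  (M : (W -> Prop) -> zmodType) (Mmap : forall K L : W -> Prop, W -> M K -> M L)
  (d : nat) (c : chain_ty G M) : chain_ty G M :=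
  fun tau =>
    pif (rel_cell X A d tau /\ orb_rep G tau = tau)
      (\sum_(sigma <- chain_supp c) \sum_(j < d.+2)
         pif (rel_cell X A d (face j sigma) /\ orb_rep G (face j sigma) = tau)
           (let v := Mmap (stab G sigma) (stab G tau)
                          (transporter G (face j sigma) tau) (c sigma) in
            if odd j then - v else v)).

Definition bredon_cycle (W : groupType) (G : W -> Prop) (X A : (W -> Prop) -> Prop)
  (M : (W -> Prop) -> zmodType) (Mmap : forall K L : W -> Prop, W -> M K -> M L)
  (i : nat) (c : chain_ty G M) : Prop :=
  is_chain X A i c /\
  (if i is k.+1 then forall tau, bredon_bd X A Mmap k c tau = 0 else True).

Definition bredon_boundary (W : groupType) (G : W -> Prop) (X A : (W -> Prop) -> Prop)
  (M : (W -> Prop) -> zmodType) (Mmap : forall K L : W -> Prop, W -> M K -> M L)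
  (i : nat) (c : chain_ty G M) : Prop :=
  exists b, is_chain X A i.+1 b /\ forall tau, c tau = bredon_bd X A Mmap i b tau.

Definition chain_add (W : groupType) (G : W -> Prop) (M : (W -> Prop) -> zmodType)
  (c1 c2 : chain_ty G M) : chain_ty G M := fun sigma => c1 sigma + c2 sigma.
Definition chain_opp (W : groupType) (G : W -> Prop) (M : (W -> Prop) -> zmodType)
  (c : chain_ty G M) : chain_ty G M := fun sigma => - c sigma.

(* Restriction M_T of M to W_T: M_T(W_T/K) = M(W/K) for K <= W_T, with the  *)
(* induced maps M_T(R_g) = M(R_g), g in W_T.  It has the same data as M; the *)
(* acting group W_T is recorded in the chain complex below.                  *)

Definition restr_mod (W : groupType) (N : nat) (s : 'I_N -> W) (T : {set 'I_N})
  (M : (W -> Prop) -> zmodType) : (W -> Prop) -> zmodType := M.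
Definition restr_map (W : groupType) (N : nat) (s : 'I_N -> W) (T : {set 'I_N})
  (M : (W -> Prop) -> zmodType) (Mmap : forall K L : W -> Prop, W -> M K -> M L) :
  forall K L : W -> Prop, W -> restr_mod s T M K -> restr_mod s T M L := Mmap.

Definition dsum_ty (W : groupType) (N : nat) (s : 'I_N -> W) (M : (W -> Prop) -> zmodType) : Type :=
  forall T : {set 'I_N}, chain_ty (special s T) (restr_mod s T M).

Definition dsum_add (W : groupType) (N : nat) (s : 'I_N -> W) (M : (W -> Prop) -> zmodType)
  (c1 c2 : dsum_ty s M) : dsum_ty s M := fun T => chain_add (c1 T) (c2 T).
Definition dsum_opp (W : groupType) (N : nat) (s : 'I_N -> W) (M : (W -> Prop) -> zmodType)
  (c : dsum_ty s M) : dsum_ty s M := fun T => chain_opp (c T).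

Definition dsum_pred (W : groupType) (N : nat) (s : 'I_N -> W) (M : (W -> Prop) -> zmodType)
  (n : nat) (P : forall T : {set 'I_N}, chain_ty (special s T) (restr_mod s T M) -> Prop)
  (c : dsum_ty s M) : Prop :=
  forall T : {set 'I_N},
    ((spherical s T /\ #|T| = n)%N -> P T (c T)) /\
    (~ (spherical s T /\ #|T| = n)%N -> forall sigma, c T sigma = 0).

(* Isomorphism of subquotients Z_1/B_1 ~= Z_2/B_2 (B_k <= Z_k subgroups of   *)
(* abelian groups), given by mutually inverse homomorphisms of the quotients *)
(* described through set-theoretic lifts f, g.                               *)

Definition subquot_iso (A B : Type) (addA : A -> A -> A) (oppA : A -> A)
  (addB : B -> B -> B) (oppB : B -> B)
  (ZA BA : A -> Prop) (ZB BB : B -> Prop) : Prop :=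
  exists (f : A -> B) (g : B -> A),
  [/\ (forall z, ZA z -> ZB (f z)) /\ (forall z, ZB z -> ZA (g z)),
      (forall z, BA z -> BB (f z)) /\ (forall z, BB z -> BA (g z)),
      (forall z1 z2, ZA z1 -> ZA z2 -> BB (addB (f (addA z1 z2)) (oppB (addB (f z1) (f z2))))) /\
      (forall z1 z2, ZB z1 -> ZB z2 -> BA (addA (g (addB z1 z2)) (oppA (addA (g z1) (g z2))))) &
      (forall z, ZA z -> BA (addA (g (f z)) (oppA z))) /\
      (forall z, ZB z -> BB (addB (f (g z)) (oppB z)))].

(* Main.v *)
(* A relative simplex of (Sigma_n, Sigma_{n-1}) is a chain of spherical cosets
   whose largest element is a coset w W_T with |T| = n.  Translating by w^-1
   turns it into a chain with top W_T, that is, a relative simplex of the Coxeter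
   cell of W_T, and two chains with top W_T are W-conjugate iff they are
   W_T-conjugate and have the same stabilizer in W and in W_T.  So W-orbits of
   simplices on the left are W_T-orbits on the right, T running over the rank-n
   spherical subsets, and transporting coefficients along these translations is an
   isomorphism already of relative chain complexes.

   The rank of a coset must be well defined: s_i in W_T forces i in T.  This is
   read off from the reflection representation over the algebraic numbers, where
   W_T fixes all coordinates outside T and s_i negates the i-th one. *)

Require Import Defs.
From HB Require Import structures.
From mathcomp Require Import all_boot all_algebra.
From mathcomp Require Import all_field ring zify boolp.
From Stdlib Require Import ClassicalEpsilon.

Set Implicit Arguments.
Unset Strict Implicit.
Unset Printing Implicit Defensive.

Import GRing.Theory Num.Theory.
Local Open Scope ring_scope.

(** * The reflection representation *)

Section UnitGroup.
Variable R : unitRingType.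

(** The universal property of a Coxeter system has a [groupType] as its target; invertible matrices
    are packaged as one here. *)
Inductive unit_group := UnitGroup (x : R) of x \is a GRing.unit.
Definition uval u := let: UnitGroup x _ := u in x.

HB.instance Definition _ := [isSub for uval].
HB.instance Definition _ := [Choice of unit_group by <:].

Definition unit_group1 := UnitGroup (unitr1 R).

Lemma unit_group_invP u : (uval u)^-1 \is a GRing.unit.
Proof. by rewrite unitrV (valP u). Qed.
Definition unit_group_inv u := UnitGroup (unit_group_invP u).

Lemma unit_group_mulP u v : uval u * uval v \is a GRing.unit.
Proof. by rewrite (unitrMr _ (valP u)) (valP v). Qed.
Definition unit_group_mul u v := UnitGroup (unit_group_mulP u v).

Fact unit_group_mulA : associative unit_group_mul.
Proof. by move=> u v w; apply/val_inj/mulrA. Qed.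
Fact unit_group_mul1u : left_id unit_group1 unit_group_mul.
Proof. by move=> u; apply/val_inj/mul1r. Qed.
Fact unit_group_mulu1 : right_id unit_group1 unit_group_mul.
Proof. by move=> u; apply/val_inj/mulr1. Qed.
Fact unit_group_mulVu : left_inverse unit_group1 unit_group_inv unit_group_mul.
Proof. by move=> u; apply/val_inj/(mulVr (valP u)). Qed.
Fact unit_group_muluV : right_inverse unit_group1 unit_group_inv unit_group_mul.
Proof. by move=> u; apply/val_inj/(mulrV (valP u)). Qed.

HB.instance Definition _ := isGroup.Build unit_group unit_group_mulA
  unit_group_mul1u unit_group_mulu1 unit_group_mulVu unit_group_muluV.

Lemma uvalX (u : unit_group) k : uval (u ^+ k)%g = uval u ^+ k.
Proof. by elim: k => [|k IHk]; rewrite ?expg0 // expgS exprS -IHk. Qed.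
End UnitGroup.

(** Right multiplication by [X] scales [v] by [a] and [w] by [b], so the coefficients obey $S_{k+1}
    = 1 + S_k a$, and likewise for [b]. A power of [X] is thus trivial once both geometric sums
    vanish. *)
Lemma rank2_perturbation_expr (F : fieldType) (n k : nat) (X : 'M[F]_n.+1)
    (p q : 'cV_n.+1) (v w : 'rV_n.+1) (a b : F) :
  X = 1 + p *m v + q *m w -> v *m X = a *: v -> w *m X = b *: w ->
  X ^+ k = 1 + (\sum_(i < k) a ^+ i) *: (p *m v) + (\sum_(i < k) b ^+ i) *: (q *m w).
Proof.
move=> defX vX wX; elim: k => [|k IHk].
  by rewrite expr0 !big_ord0 !scale0r !addr0.
have sumS (c : F) : \sum_(i < k.+1) c ^+ i = 1 + (\sum_(i < k) c ^+ i) * c.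
  rewrite big_ord_recl expr0 big_distrl; congr (_ + _).
  by apply: eq_bigr => i _; rewrite exprSr.
rewrite exprSr IHk !mulrDl mul1r -!mulmxE -!scalemxAl -!mulmxA vX wX.
rewrite -!scalemxAr !scalerA !sumS {1}defX !scalerDl !scale1r.
by rewrite -!addrA; congr (_ + (_ + _)); rewrite addrCA.
Qed.

Lemma geometric_sum_eq0 (F : fieldType) (k : nat) (a : F) :
  a != 1 -> a ^+ k = 1 -> \sum_(i < k) a ^+ i = 0.
Proof.
move=> a1 ak; apply/eqP; have := subrX1 a k; rewrite ak subrr => /esym/eqP.
by rewrite mulf_eq0 subr_eq0 (negPf a1).
Qed.

(** * Reflections attached to a square matrix *)

Section Reflections.
Variables (F : fieldType) (n : nat) (A : 'M[F]_n.+1).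

(** Acting on row vectors from the right, this sends $e_j$ to $e_j - A_{ji} e_i$: the formula of the
    canonical reflection representation when [A] is twice the matrix of its bilinear form. *)
Definition reflection_mx (i : 'I_n.+1) : 'M[F]_n.+1 :=
  1 - col i A *m delta_mx 0 i.

Lemma delta_reflection_mx i j :
  (delta_mx 0 i : 'rV_n.+1) *m reflection_mx j
    = delta_mx 0 i - A i j *: delta_mx 0 j.
Proof.
rewrite /reflection_mx mulmxBr mulmx1 mulmxA -rowE; congr (_ - _).
rewrite (mx11_scalar (row i (col j A))) mul_scalar_mx.
by rewrite !mxE.
Qed.

Lemma reflection_mx_sqr i : A i i = 2%:R -> reflection_mx i * reflection_mx i = 1.
Proof.
move=> Aii; rewrite [X in X * _]/reflection_mx mulrBl mul1r -mulmxE -mulmxA.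
rewrite delta_reflection_mx Aii /reflection_mx scaler_nat opprD.
by rewrite addrA subrr sub0r mulmxN opprK subrK.
Qed.

(* For c = z + 1/z the rows e_i - z e_j and e_i - z^-1 e_j span the plane
   moved by the product and are eigenvectors for z^2 and z^-2. *)
Lemma reflection_mx_braid i j z k :
    A i i = 2%:R -> A j j = 2%:R -> A i j = z + z^-1 -> A j i = z + z^-1 ->
    z != 0 -> z ^+ 2 != 1 -> (z ^+ 2) ^+ k = 1 ->
  (reflection_mx i * reflection_mx j) ^+ k = 1.
Proof.
move=> Aii Ajj Aij Aji z0 z2 zk; set X := _ * _.
pose ei : 'rV[F]_n.+1 := delta_mx 0 i; pose ej : 'rV[F]_n.+1 := delta_mx 0 j.
pose c := z + z^-1.
have eiX : ei *m X = c *: ej - ei.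
  rewrite /X -mulmxE mulmxA /ei delta_reflection_mx Aii scaler_nat mulr2n opprD.
  by rewrite addrA subrr sub0r mulNmx delta_reflection_mx Aij opprB.
have ejX : ej *m X = (c ^+ 2 - 1) *: ej - c *: ei.
  rewrite /X -mulmxE mulmxA /ej delta_reflection_mx Aji mulmxBl -scalemxAl.
  rewrite !delta_reflection_mx Ajj Aij -/c -/ej -/ei.
  by apply/rowP => l; rewrite !mxE; ring.
have eig y : y != 0 -> c = y + y^-1 ->
    (ei - y *: ej) *m X = y ^+ 2 *: (ei - y *: ej).
  move=> y0 cy; rewrite mulmxBl -scalemxAl eiX ejX.
  apply/rowP => l; rewrite !mxE cy; field.
  by [].
have zV0 : z^-1 != 0 by rewrite invr_eq0.
have vX := eig z z0 erefl.
have wX := eig z^-1 zV0 _; rewrite invrK in wX; have {}wX := wX (addrC _ _).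
(* [d] is the determinant of the coefficients of the two eigenvectors, nonzero because $z^2 \ne 1$;
   [dec] is the resulting change of basis. *)
pose d := z - z^-1.
have d0 : d != 0.
  by apply: contra z2; rewrite subr_eq0 => /eqP zz; rewrite expr2 {2}zz mulfV.
have dec P Q : P *m ei + Q *m ej = (d^-1 *: (- z^-1 *: P - Q)) *m (ei - z *: ej)
    + (d^-1 *: (z *: P + Q)) *m (ei - z^-1 *: ej).
  rewrite -!scalemxAl !mulmxDl !mulNmx !mulmxBr -!scalemxAl -!scalemxAr.
  apply/matrixP => x y; rewrite !mxE.
  set Pi := \sum_ _ _; set Qj := \sum_ _ _; set Pj := \sum_ _ _; set Qi := \sum_ _ _.
  move: d0; rewrite /d; clearbody Pi Qj Pj Qi => d0'.
  field; rewrite z0 /= -expr2 subr_eq0 z2.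
  by [].
have defX : exists p q, X = 1 + p *m (ei - z *: ej) + q *m (ei - z^-1 *: ej).
  have -> : X = 1 + ((- col i A) *m ei + (c *: col i A - col j A) *m ej).
    rewrite /X /reflection_mx mulrBl mul1r -!mulmxE -/ei -/ej -mulmxA.
    have := delta_reflection_mx i j; rewrite /reflection_mx -/ei -/ej Aij -/c => ->.
    rewrite mulmxBr mulmxBl mulNmx -scalemxAr -scalemxAl opprB.
    by rewrite -addrA; congr (_ + _); rewrite addrCA [RHS]addrCA [- _ - _]addrC.
  by rewrite dec addrA; do 2!eexists.
have [p [q]] := defX => /rank2_perturbation_expr - /(_ k _ _ vX wX) ->.
(* The eigenvalues $z^2$ and $z^{-2}$ are $k$-th roots of unity other than 1, so both sums
   vanish. *)
rewrite !geometric_sum_eq0 ?scale0r ?addr0 //.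
  by rewrite exprVn invr_eq1.
by rewrite exprVn exprVn zk invr1.
Qed.

(** Equivalently, right multiplication by [X] keeps the coordinates of row vectors outside [T]. The
    invertible such matrices form a group, which will contain the image of $W_T$. *)
Definition fix_cols (T : {set 'I_n.+1}) (X : 'M[F]_n.+1) :=
  forall k, k \notin T -> col k X = col k 1.

Lemma fix_cols1 T : fix_cols T 1. Proof. by []. Qed.

Lemma fix_colsM T X Y : fix_cols T X -> fix_cols T Y -> fix_cols T (X * Y).
Proof.
move=> fX fY k kT; rewrite -mulmxE !colE -mulmxA -[Y *m _]colE fY // colE.
by rewrite mulmxA mulmx1 -!colE fX.
Qed.

Lemma fix_colsV T X : X \is a GRing.unit -> fix_cols T X -> fix_cols T X^-1.
Proof.
move=> uX fX k kT.
have: X^-1 *m col k X = X^-1 *m col k 1 by rewrite fX.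
by rewrite !colE !mulmxA mulmx1 mulmxE mulVr // => <-.
Qed.

Lemma fix_cols_reflection (T : {set 'I_n.+1}) i : i \in T -> fix_cols T (reflection_mx i).
Proof.
move=> iT k kT; apply/matrixP => x y; rewrite !mxE big_ord1 !mxE.
by rewrite (_ : k == i = false) ?mulr0 ?subr0 //; apply: contraNF kT => /eqP->.
Qed.

(** The $(i,i)$ entry of the reflection is $1 - 2 = -1$, which differs from 1 as $2 \ne 0$. *)
Lemma reflection_fix_cols (T : {set 'I_n.+1}) i :
  A i i = 2%:R -> (2%:R != 0 :> F) -> fix_cols T (reflection_mx i) -> i \in T.
Proof.
move=> Aii nz2 fT; apply/negPn/negP => /fT /matrixP /(_ i 0).
rewrite !mxE big_ord1 !mxE eqxx mulr1 Aii => /(canRL (addrK _)).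
by rewrite opprK -[X in X = _]addr0 => /addrI/esym/eqP; apply/negP.
Qed.
End Reflections.

(** The universal property yields a representation by reflections in which $W_T$ changes only
    coordinates in $T$, while $s_i$ changes the $i$-th one. *)
Lemma coxeter_generator_special (W : groupType) (N : nat) (m : 'I_N -> 'I_N -> nat)
    (s : 'I_N -> W) (T : {set 'I_N}) (i : 'I_N) :
  is_coxeter_system m s -> special s T (s i) -> i \in T.
Proof.
(* Square matrices form a ring in positive size; for $N = 0$ there is no generator. *)
case: N => [|N] in m s T i *; first by case: i.
move=> [cm _ univ] sTi.
(* The off-diagonal entries will be $z + z^{-1}$ with $z$ a primitive $2l$-th root of unity, $l =
   m_{ij}$: up to Galois conjugation this is $2\cos(\pi/l)$, and $z^2$ has order $l$. For $l = 0$,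
   that is $m_{ij} = \infty$, no relation has to hold and $z = 1$ serves. *)
have zP l : exists z : algC, [/\ z != 0, (1 < l)%N -> z ^+ 2 != 1 & (z ^+ 2) ^+ l = 1].
  have [->|l0] := posnP l; first by exists 1; rewrite oner_eq0 expr0.
  have [|z zp] := @C_prim_root_exists (2 * l); first by rewrite muln_gt0.
  exists z; split.
  - apply/eqP => z0; have /eqP := prim_expr_order zp.
    by rewrite z0 expr0n muln_eq0 (gtn_eqF l0) eq_sym oner_eq0.
  - by move=> l1; rewrite -(prim_order_dvd zp) gtnNdvd //; lia.
  - by rewrite -exprM prim_expr_order.
pose z l := sval (cid (zP l)).
have zE l : [/\ z l != 0, (1 < l)%N -> z l ^+ 2 != 1 & (z l ^+ 2) ^+ l = 1].
  exact: svalP (cid (zP l)).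
pose A : 'M[algC]_N.+1 :=
  \matrix_(i, j) if i == j then 2%:R else z (m i j) + (z (m i j))^-1.
have A2 j : A j j = 2%:R by rewrite mxE eqxx.
have uR j : reflection_mx A j \is a GRing.unit.
  by apply/unitrP; exists (reflection_mx A j); rewrite reflection_mx_sqr.
pose h j : unit_group 'M[algC]_N.+1 := UnitGroup (uR j).
have [|f [[fM fs] _]] := univ _ h.
  move=> j k mjk; apply: val_inj; rewrite /= uvalX /=.
  have [<-|njk] := eqVneq j k.
    by rewrite reflection_mx_sqr // expr1n.
  have [msym m1] := cm j k; have [z0 z2 zm] := zE (m j k).
  have AE : A j k = z (m j k) + (z (m j k))^-1 by rewrite mxE (negPf njk).
  have AE' : A k j = z (m j k) + (z (m j k))^-1.
    by rewrite mxE eq_sym (negPf njk) msym.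
  apply: (reflection_mx_braid (A2 j) (A2 k) AE AE') => //; apply: z2.
  by move: m1 mjk; rewrite (negPf njk); case: (m j k) => [|[]].
have f1 : f 1%g = 1%g by apply: (mulgI (f 1%g)); rewrite -fM !mulg1.
have fV x : f x^-1%g = (f x)^-1%g.
  by apply: (mulgI (f x)); rewrite -fM !mulgV.
apply: (@reflection_fix_cols _ _ A) => //; first by rewrite pnatr_eq0.
rewrite -[reflection_mx A i]/(uval (h i)) -fs.
(* Membership in [special] is tested on the subgroup of elements whose image satisfies
   [fix_cols T]. *)
apply: (sTi (fun w => fix_cols T (uval (f w)))) => [|j jT]; last first.
  by rewrite fs; apply: fix_cols_reflection.
split; first by rewrite f1; apply: fix_cols1.
split=> [x y fx fy | x fx]; first by rewrite fM; apply: fix_colsM.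
by rewrite fV; apply: fix_colsV => //; apply: valP.
Qed.

(** * Finitely supported sums *)

Section ListLemmas.

Lemma InP (A : eqType) (x : A) (l : seq A) : List.In x l <-> x \in l.
Proof.
elim: l => [|y l IHl] //=; rewrite inE; split.
  by case=> [->|/IHl ->]; rewrite ?eqxx ?orbT.
by case/orP => [/eqP->|/IHl]; [left | right].
Qed.

Lemma NoDupP (A : eqType) (l : seq A) : List.NoDup l <-> uniq l.
Proof.
elim: l => [|y l IHl] /=; first by split=> // _; apply: List.NoDup_nil.
split=> [nd|/andP[yl /IHl nd]].
  inversion nd as [|? ? yl nd']; subst.
  by rewrite (IHl.1 nd') andbT; apply/negP => /InP.
by apply: List.NoDup_cons => // /InP; apply/negP.
Qed.

Lemma NoDup_cover (A : Type) (l : seq A) :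
  exists l', List.NoDup l' /\ forall x, List.In x l -> List.In x l'.
Proof.
exists (undup (l : seq {classic A})); split.
  exact/(@NoDupP {classic A})/undup_uniq.
by move=> x /(@InP {classic A}) xl; apply/(@InP {classic A}); rewrite mem_undup.
Qed.

(** Supports of chains are covered by arbitrarily chosen lists, which may contain points of value
    zero. Hence [phi] has to match only the nonzero terms of the two sums. *)
Lemma big_uniq_reindex (A B : eqType) (V : zmodType) (l1 : seq A) (l2 : seq B)
    (phi : A -> B) (F : A -> V) (H : B -> V) :
  uniq l1 -> uniq l2 ->
  (forall a, a \in l1 -> F a != 0 -> phi a \in l2 /\ H (phi a) = F a) ->
  (forall a a', F a != 0 -> F a' != 0 -> phi a = phi a' -> a = a') ->
  (forall b, b \in l2 -> H b != 0 -> exists a, [/\ a \in l1, phi a = b & F a = H b]) ->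
  \sum_(a <- l1) F a = \sum_(b <- l2) H b.
Proof.
move=> u1 u2 FH injF HF.
have drop0 (C : eqType) (l : seq C) (K : C -> V) :
    \sum_(x <- l) K x = \sum_(x <- l | K x != 0) K x.
  rewrite (bigID (fun x => K x != 0)) /= [X in _ + X]big1 ?addr0 // => x.
  by rewrite negbK => /eqP.
rewrite drop0 [RHS]drop0 -[LHS]big_filter -[RHS]big_filter.
set k1 := filter _ l1; set k2 := filter _ l2.
have inj1 : {in k1 &, injective phi}.
  by move=> a a'; rewrite !mem_filter => /andP[a0 _] /andP[a0' _]; apply: injF.
have eq12 : perm_eq (map phi k1) k2.
  apply: uniq_perm; rewrite ?map_inj_in_uniq ?filter_uniq // => b.
  apply/mapP/idP => [[a]|].
    by rewrite !mem_filter => /andP[a0 /FH/(_ a0) [? eqF]] ->; rewrite eqF a0.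
  rewrite mem_filter => /andP[b0 /HF/(_ b0) [a [al ab Fa]]].
  by exists a => //; rewrite mem_filter Fa b0.
rewrite -(perm_big _ eq12) big_map big_seq [RHS]big_seq; apply: eq_bigr => a.
by rewrite mem_filter => /andP[a0 /FH/(_ a0) []].
Qed.

Lemma big_NoDup_reindex (A B : Type) (V : zmodType) (l1 : seq A) (l2 : seq B)
    (phi : A -> B) (F : A -> V) (H : B -> V) :
  List.NoDup l1 -> List.NoDup l2 ->
  (forall a, List.In a l1 -> F a != 0 -> List.In (phi a) l2 /\ H (phi a) = F a) ->
  (forall a a', F a != 0 -> F a' != 0 -> phi a = phi a' -> a = a') ->
  (forall b, List.In b l2 -> H b != 0 ->
     exists a, [/\ List.In a l1, phi a = b & F a = H b]) ->
  \sum_(a <- l1) F a = \sum_(b <- l2) H b.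
Proof.
move=> /(@NoDupP {classic A}) u1 /(@NoDupP {classic B}) u2 FH injF HF.
apply: (@big_uniq_reindex {classic A} {classic B} V l1 l2 phi) => //.
  by move=> a /InP al a0; have [/(@InP {classic B})] := FH a al a0.
move=> b /InP bl b0; have [a [al ab Fab]] := HF b bl b0.
by exists a; split=> //; apply/(@InP {classic A}).
Qed.

End ListLemmas.

Lemma pif_true (P : Prop) (V : zmodType) (x : V) : P -> pif P x = x.
Proof. by rewrite /pif; case: excluded_middle_informative. Qed.

Lemma pif_false (P : Prop) (V : zmodType) (x : V) : ~ P -> pif P x = 0.
Proof. by rewrite /pif; case: excluded_middle_informative. Qed.

Lemma pif_neq0 (P : Prop) (V : zmodType) (x : V) : pif P x != 0 -> P /\ x != 0.
Proof. by rewrite /pif; case: excluded_middle_informative => // ? /eqP. Qed.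

Lemma eq_pif (P Q : Prop) (V : zmodType) (x y : V) :
  (P <-> Q) -> (P -> x = y) -> pif P x = pif Q y.
Proof.
move=> PQ xy; case: (excluded_middle_informative P) => [p|np].
  by rewrite !pif_true ?xy //; apply/PQ.
by rewrite !pif_false // => /PQ.
Qed.

(** * Simplices, orbits and stabilizers *)

Section Translation.
Variable W : groupType.
Implicit Types (g h : W) (Y : W -> Prop) (G : W -> Prop) (sigma tau : seq (W -> Prop)).

Local Notation whole := (fun _ : W => True).

Lemma lact1 Y : lact 1%g Y = Y.
Proof. by apply/funext => x; rewrite /lact invg1 mul1g. Qed.

Lemma lactM g h Y : lact (g * h)%g Y = lact g (lact h Y).
Proof. by apply/funext => x; rewrite /lact invgM mulgA. Qed.

Lemma act1 sigma : act 1%g sigma = sigma.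
Proof. by rewrite -[RHS]map_id; apply: eq_map => Y; apply: lact1. Qed.

Lemma actM g h sigma : act (g * h)%g sigma = act g (act h sigma).
Proof. by rewrite /act -map_comp; apply: eq_map => Y; apply: lactM. Qed.

Lemma actK g : cancel (act g) (act g^-1%g).
Proof. by move=> sigma; rewrite -actM mulVg act1. Qed.

Lemma face_act j g sigma : face j (act g sigma) = act g (face j sigma).
Proof. by rewrite /face /act map_cat map_take map_drop. Qed.

Lemma last_act g sigma : (0 < size sigma)%N ->
  last (fun _ => False) (act g sigma) = lact g (last (fun _ => False) sigma).
Proof. by case: sigma => //= x l _; rewrite last_map. Qed.

Lemma subgroup_whole : is_subgroup whole.
Proof. by []. Qed.

Lemma stab_subgroup G sigma : is_subgroup G -> is_subgroup (stab G sigma).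
Proof.
move=> [G1 [GM GV]]; split; first by split=> //; apply: act1.
split=> [x y [Gx xs] [Gy ys]|x [Gx xs]]; split; rewrite ?actM ?ys; auto.
by rewrite -{1}xs actK.
Qed.

Lemma stab_face G j sigma g : stab G sigma g -> stab G (face j sigma) g.
Proof. by move=> [Gg gs]; split; rewrite // -face_act gs. Qed.

Lemma orb_rep_in G sigma : is_subgroup G ->
  exists g, G g /\ orb_rep G sigma = act g sigma.
Proof.
move=> [G1 _]; apply: (epsilon_spec (inhabits sigma)
  (fun tau => exists g, G g /\ tau = act g sigma)).
by exists sigma, 1%g; rewrite act1.
Qed.

(** The representative depends only on the orbit: both choices use equivalent predicates, and the
    inhabitation witnesses agree by proof irrelevance. *)
Lemma orb_rep_act G g sigma : is_subgroup G -> G g ->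
  orb_rep G (act g sigma) = orb_rep G sigma.
Proof.
move=> [_ [GM GV]] Gg; rewrite /orb_rep (Prop_irrelevance (inhabits _) (inhabits sigma)).
congr epsilon; apply/funext => tau; apply/propext; split=> [[h [Gh ->]]|[h [Gh ->]]].
  by exists (h * g)%g; rewrite actM; auto.
by exists (h * g^-1)%g; rewrite -actM mulgVK; auto.
Qed.

Lemma orb_rep_id G sigma : is_subgroup G -> orb_rep G (orb_rep G sigma) = orb_rep G sigma.
Proof. by move=> sG; have [g [Gg {1}->]] := orb_rep_in sigma sG; apply: orb_rep_act. Qed.

Lemma orb_rep_eq G sigma tau : is_subgroup G ->
  orb_rep G sigma = orb_rep G tau -> exists g, G g /\ sigma = act g tau.
Proof.
move=> sG e; have [_ [GM GV]] := sG.
have [g [Gg eg]] := orb_rep_in sigma sG; have [h [Gh eh]] := orb_rep_in tau sG.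
exists (g^-1 * h)%g; split; first by auto.
by rewrite actM -eh -e eg actK.
Qed.

Lemma transporterP G sigma tau : (exists g, G g /\ sigma = act g tau) ->
  G (transporter G sigma tau) /\ sigma = act (transporter G sigma tau) tau.
Proof. exact: (epsilon_spec (inhabits 1%g) (fun g => G g /\ sigma = act g tau)). Qed.

Lemma transporter_wholeP g sigma tau :
  sigma = act g tau -> sigma = act (transporter whole sigma tau) tau.
Proof. by move=> e; apply: (@transporterP whole _ _ _).2; exists g. Qed.

(** Two groups are allowed so that stabilizers in $W$ and in $W_T$ can be compared. *)
Lemma orbit_mor_stab (G H : W -> Prop) sigma tau g :
  (forall k, G k -> act k sigma = sigma -> H (g^-1 * k * g)%g) -> sigma = act g tau ->
  orbit_mor (stab G sigma) (stab H tau) g.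
Proof.
move=> GH e k [Gk ks]; split; first exact: GH.
by rewrite !actM -e ks e actK.
Qed.

Lemma pfinite_sub (K L : W -> Prop) : (forall x, K x -> L x) -> pfinite L -> pfinite K.
Proof. by move=> KL [l Ll]; exists l => x /KL; apply: Ll. Qed.

Lemma fin_subgroup_sub (K L : W -> Prop) :
  is_subgroup K -> (forall x, K x -> L x) -> fin_subgroup L -> fin_subgroup K.
Proof. by move=> sK KL [_ fL]; split=> //; apply: pfinite_sub fL. Qed.

Lemma strict_chain_behead Y sigma : strict_chain (Y :: sigma) -> strict_chain sigma.
Proof. by move=> sc k lt_k; apply: (sc k.+1). Qed.

Lemma strict_chain_last sigma Y : strict_chain sigma -> List.In Y sigma ->
  forall x, Y x -> last (fun _ => False) sigma x.
Proof.
elim: sigma Y => [|Z sigma IHs] Y //= sc [<-|Ys] x Yx; last first.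
  have := IHs _ (strict_chain_behead sc) Ys x Yx.
  by case: sigma Ys {IHs sc}.
case: sigma => [|Y' sigma] // in sc IHs *.
apply: (IHs Y' (strict_chain_behead sc)); first by left.
exact: (sc 0%N isT).1.
Qed.

Lemma strict_chain_act g sigma : strict_chain sigma -> strict_chain (act g sigma).
Proof.
move=> sc k; rewrite size_map => lt_k; have [sub [x [xk nxk]]] := sc k lt_k.
rewrite (nth_map (fun=> False) _ _ (ltnW lt_k)) (nth_map (fun=> False) _ _ lt_k).
split=> [y|]; first exact: sub.
by exists (g * x)%g; rewrite /lact !mulKg.
Qed.

Lemma In_last sigma : (0 < size sigma)%N -> List.In (last (fun _ : W => False) sigma) sigma.
Proof.
case: sigma => //= Y sigma _; elim: sigma Y => [|Z sigma IHs] Y /=; first by left.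
by right; have := IHs Z.
Qed.

Lemma In_face j sigma Y : List.In Y (face j sigma) -> List.In Y sigma.
Proof.
move=> /(@InP {classic (W -> Prop)}); rewrite mem_cat => Y_in.
apply/(@InP {classic (W -> Prop)}).
by case/orP: Y_in => [/mem_take|/mem_drop].
Qed.

End Translation.

(** * Cells of the Davis complex *)

Section Cells.
Variables (W : groupType) (N : nat) (s : 'I_N -> W).
Hypothesis generator_special : forall (T : {set 'I_N}) i, special s T (s i) -> i \in T.

Local Notation last0 := (last (fun _ : W => False)).
Local Notation skel_cell n := (rel_cell (Sigma_skel s n) (Sigma_skel_prev s n)).
Local Notation cell T := (rel_cell (cox_cell s T) (cox_cell_bd s T)).

(** * Special subgroups and inclusions of their cosets *)

Lemma special_subgroup (T : {set 'I_N}) : is_subgroup (special s T).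
Proof.
split; first by move=> K [].
split=> [x y Tx Ty K sK KT|x Tx K sK KT]; have [K1 [KM KV]] := sK.
  by apply: KM; [apply: Tx | apply: Ty].
by apply: KV; apply: Tx.
Qed.

Lemma special1 (T : {set 'I_N}) : special s T 1%g.
Proof. exact: (special_subgroup T).1. Qed.

Lemma specialM (T : {set 'I_N}) x y :
  special s T x -> special s T y -> special s T (x * y)%g.
Proof. exact: (special_subgroup T).2.1. Qed.

Lemma specialV (T : {set 'I_N}) x : special s T x -> special s T x^-1%g.
Proof. exact: (special_subgroup T).2.2. Qed.

Lemma special_gen (T : {set 'I_N}) i : i \in T -> special s T (s i).
Proof. by move=> iT K _; apply. Qed.

Lemma special_mono (U T : {set 'I_N}) x : U \subset T -> special s U x -> special s T x.
Proof. by move=> /subsetP UT Ux K sK KT; apply: Ux => // i /UT/KT. Qed.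

Lemma coset_self w (T : {set 'I_N}) : coset s w T w.
Proof. by rewrite /coset mulVg; apply: special1. Qed.

Lemma coset1 (T : {set 'I_N}) : coset s 1%g T = special s T.
Proof. by apply/funext => x; rewrite /coset invg1 mul1g. Qed.

Lemma lact_coset g w (T : {set 'I_N}) : lact g (coset s w T) = coset s (g * w)%g T.
Proof. by apply/funext => x; rewrite /lact /coset invgM mulgA. Qed.

Lemma lact_special g (T : {set 'I_N}) : lact g (special s T) = coset s g T.
Proof. by rewrite -coset1 lact_coset mulg1. Qed.

Lemma coset_eq w w' (T : {set 'I_N}) : special s T (w'^-1 * w)%g -> coset s w T = coset s w' T.
Proof.
move=> Tw; apply/funext => x; apply/propext; rewrite /coset; split=> [Tx|Tx].
  by rewrite -[x](mulVKg w) mulgA; apply: specialM.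
have -> : (w^-1 * x = (w'^-1 * w)^-1 * (w'^-1 * x))%g by rewrite invgM invgK mulgA mulgK.
by apply: specialM => //; apply: specialV.
Qed.

Lemma coset_special w (T : {set 'I_N}) : special s T w -> coset s w T = special s T.
Proof. by move=> Tw; rewrite -coset1; apply: coset_eq; rewrite invg1 mul1g. Qed.

(** For $i \in T$ both $w$ and $w s_i$ lie in $w' W_{T'}$, so $s_i \in W_{T'}$ and
    [generator_special] applies. This is how the Coxeter presentation enters the combinatorics of
    cosets. *)
Lemma coset_sub w w' (T T' : {set 'I_N}) :
  (forall x, coset s w T x -> coset s w' T' x) ->
  special s T' (w'^-1 * w)%g /\ T \subset T'.
Proof.
move=> sub; have Tw : special s T' (w'^-1 * w)%g by apply: sub; apply: coset_self.
split=> //; apply/subsetP => i iT; apply: generator_special.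
rewrite -[s i](mulKg (w'^-1 * w)%g); apply: specialM; first exact: specialV.
rewrite -mulgA; apply: sub; rewrite /coset mulKg.
exact: special_gen.
Qed.

Lemma coset_sub_eq w w' (T T' : {set 'I_N}) : (#|T'| <= #|T|)%N ->
  (forall x, coset s w T x -> coset s w' T' x) ->
  T = T' /\ coset s w T = coset s w' T'.
Proof.
move=> cardT /coset_sub [Tw sTT']; have eT : T = T' by apply/eqP; rewrite eqEcard sTT'.
by split=> //; rewrite eT; apply: coset_eq.
Qed.

Lemma coset_inj w w' (T T' : {set 'I_N}) : coset s w T = coset s w' T' -> T = T'.
Proof.
move=> e; apply/eqP; rewrite eqEsubset; apply/andP; split.
  by apply: (@coset_sub w w' T T' _).2; rewrite e.
by apply: (@coset_sub w' w T' T _).2; rewrite e.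
Qed.

(** The stabilizer lies in $w W_T w^{-1}$, which is listed by conjugating a list for $W_T$. *)
Lemma coset_fin_stab w (T : {set 'I_N}) : spherical s T ->
  pfinite (fun g => lact g (coset s w T) = coset s w T).
Proof.
move=> [l Tl]; exists [seq w * y * w^-1 | y <- l]%g => g gT.
apply/mapP; exists (w^-1 * (g * w))%g; last by rewrite mulVKg mulgK.
by apply: Tl; have := @coset_self (g * w)%g T; rewrite -lact_coset gT.
Qed.

(** * Relative simplices of the skeleta and of the Coxeter cells *)

Lemma skel_cell_size n d sigma : skel_cell n d sigma -> (0 < size sigma)%N.
Proof. by case=> ->. Qed.

Lemma Forall_act (P : (W -> Prop) -> Prop) g sigma :
  (forall Y, P Y -> P (lact g Y)) -> List.Forall P sigma -> List.Forall P (act g sigma).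
Proof. by move=> Pg; elim=> [|Y l PY _ IH]; constructor; auto. Qed.

Lemma Sigma_skel_lact n g Y : Sigma_skel s n Y -> Sigma_skel s n (lact g Y).
Proof.
by move=> [w [T [sT cT ->]]]; exists (g * w)%g, T; rewrite lact_coset.
Qed.

Lemma Sigma_skel_prev_lact n g Y : Sigma_skel_prev s n Y -> Sigma_skel_prev s n (lact g Y).
Proof. by case: n => // n; apply: Sigma_skel_lact. Qed.

Lemma skel_cell_act n d g sigma : skel_cell n d sigma -> skel_cell n d (act g sigma).
Proof.
move=> [sz sc FX nFA]; split; first by rewrite size_map.
- exact: strict_chain_act.
- by apply: Forall_act FX => Y; apply: Sigma_skel_lact.
- move=> FA; apply: nFA; rewrite -[sigma](actK g).
  by apply: Forall_act FA => Y; apply: Sigma_skel_prev_lact.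
Qed.

(** An element fixing the chain fixes its first vertex, a spherical coset with finite stabilizer. *)
Lemma skel_cell_stab n d sigma (G : W -> Prop) :
  is_subgroup G -> skel_cell n d sigma -> fin_subgroup (stab G sigma).
Proof.
move=> sG [sz _ /List.Forall_forall FX _]; split; first exact: stab_subgroup.
case: sigma => // Y sigma in sz FX *.
have [w [T [sT _ eY]]] := FX Y (or_introl erefl).
apply: pfinite_sub (coset_fin_stab w sT) => g [_ [gY _]].
by rewrite -eY.
Qed.

(** A coset determines its type $T$, so its rank decides membership. For $n = 0$ both sides are
    false. *)
Lemma Sigma_skel_prevP n w (T : {set 'I_N}) : spherical s T ->
  Sigma_skel_prev s n (coset s w T) <-> (#|T| < n)%N.
Proof.
move=> sT; case: n => [|n] //=; split=> [[w' [T' [_ cT' /coset_inj ->]]]|cT] //.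
by exists w, T.
Qed.

Lemma not_Forall (P : (W -> Prop) -> Prop) sigma :
  ~ List.Forall P sigma -> exists Y, List.In Y sigma /\ ~ P Y.
Proof.
move=> nP; apply: contrapT => nex; apply/nP/List.Forall_forall => Y Ys.
by apply: contrapT => nPY; apply: nex; exists Y.
Qed.

(** Some vertex lies outside $\Sigma_{n-1}$ and so has rank $n$; the top contains it, hence has rank
    at least $n$. *)
Lemma skel_cell_last n d sigma : skel_cell n d sigma ->
  exists w T, [/\ spherical s T, #|T| = n & last0 sigma = coset s w T].
Proof.
move=> cs; have sz := skel_cell_size cs; case: cs => [_ sc /List.Forall_forall FX nFA].
have [Y [Ys nAY]] := not_Forall nFA.
have [w [T [sT cT eY]]] := FX Y Ys.
have [w' [T' [sT' cT' eL]]] := FX _ (In_last sz).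
exists w', T'; split=> //; apply/eqP; rewrite eqn_leq cT' /=.
have [_ TT'] : special s T' (w'^-1 * w)%g /\ T \subset T'.
  by apply: coset_sub => x; rewrite -eY -eL; apply: strict_chain_last.
rewrite (leq_trans _ (subset_leq_card TT')) // leqNgt.
by apply/negP => /(Sigma_skel_prevP n w sT); rewrite -eY.
Qed.

(** The top of the face is a rank $n$ coset inside the top of [sigma], also of rank $n$, so they are
    equal. Thus the relative differential never mixes different tops, which is why the complex
    splits. *)
Lemma skel_cell_face_last n d d' j sigma :
  skel_cell n d sigma -> skel_cell n d' (face j sigma) -> last0 (face j sigma) = last0 sigma.
Proof.
move=> cs cf; have [w [T [_ cT eL]]] := skel_cell_last cs.
have [w' [T' [_ cT' eL']]] := skel_cell_last cf.
rewrite eL eL'; apply: (@coset_sub_eq w' w T' T _ _).2 => [|x]; first by rewrite cT cT'.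
rewrite -eL -eL'; case: cs => _ sc _ _; apply: strict_chain_last => //.
by apply/In_face/In_last; apply: skel_cell_size cf.
Qed.

(** A chain of faces of $C_{W_T}$ leaves the boundary exactly when it contains the whole cell, which
    is then its top. *)
Lemma cellP n d (T : {set 'I_N}) tau : spherical s T -> #|T| = n ->
  cell T d tau <-> skel_cell n d tau /\ last0 tau = special s T.
Proof.
move=> sT cT; split=> [[sz sc FX nFA]|[ct eL]].
  have lt0 : (0 < size tau)%N by rewrite sz.
  have eL : last0 tau = special s T.
    have [Y [Ys nAY]] := not_Forall nFA.
    have /List.Forall_forall FX' := FX.
    have [u [U [Tu UT eY]]] := FX' Y Ys.
    have [u' [U' [Tu' UT' eL]]] := FX' _ (In_last lt0).
    have UeT : U = T.
      apply/eqP; rewrite eqEproper UT /=; apply/negP => pUT.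
      by apply: nAY; exists u, U.
    have [_ TU'] : special s U' (u'^-1 * u)%g /\ U \subset U'.
      by apply: coset_sub => x; rewrite -eL -eY; apply: strict_chain_last.
    have U'eT : U' = T by apply/eqP; rewrite eqEsubset UT' -UeT.
    by rewrite eL U'eT coset_special.
  split=> //; split=> //.
    apply: List.Forall_impl FX => Y [u [U [Tu UT ->]]]; exists u, U; split=> //.
      by apply: pfinite_sub sT => x; apply: special_mono.
    by rewrite -cT subset_leq_card.
  move=> /List.Forall_forall /(_ _ (In_last lt0)).
  by rewrite eL -coset1 => /(Sigma_skel_prevP n _ sT); rewrite cT ltnn.
(* Conversely, every vertex is contained in the top $W_T$, so it is a face of the cell, and the top
   itself is not in the boundary. *)
have lt0 := skel_cell_size ct; case: ct => [sz sc /List.Forall_forall FX _].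
split=> //.
  apply/List.Forall_forall => Y Yt; have [w [U [sU cU eY]]] := FX Y Yt.
  have [Tw UT] : special s T (1^-1 * w)%g /\ U \subset T.
    by apply: coset_sub => x; rewrite -eY coset1 -eL; apply: strict_chain_last.
  by exists w, U; rewrite invg1 mul1g in Tw.
move=> /List.Forall_forall /(_ _ (In_last lt0)) [u [U [_ /proper_neq/eqP UT]]].
by rewrite eL -coset1 => /coset_inj eT; apply: UT.
Qed.

(** These pairs ([T], [tau]) index the summands of the right-hand complex in degree [d]. *)
Definition cell_rep n d (T : {set 'I_N}) (tau : seq (W -> Prop)) : Prop :=
  [/\ spherical s T, #|T| = n, cell T d tau & orb_rep (special s T) tau = tau].

(** * $W$-orbits of simplices versus $W_T$-orbits *)

Section Rep.
Variables (n d : nat).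

Lemma cell_rep_skel T tau : cell_rep n d T tau -> skel_cell n d tau.
Proof. by move=> [sT cT /(cellP d tau sT cT) [] ]. Qed.

Lemma cell_rep_last T tau : cell_rep n d T tau -> last0 tau = special s T.
Proof. by move=> [sT cT /(cellP d tau sT cT) [] ]. Qed.

(** Comparing tops gives $g W_T = W_T$. So $W$-conjugacy of chains with top $W_T$ is already
    $W_T$-conjugacy. *)
Lemma last_special_act T g sigma tau : (0 < size tau)%N ->
  last0 sigma = special s T -> last0 tau = special s T -> sigma = act g tau ->
  special s T g.
Proof.
move=> sz eLs eLt e; have := eLs; rewrite e last_act // eLt lact_special => <-.
exact: coset_self.
Qed.

Lemma cell_rep_act_special T tau tau' g : cell_rep n d T tau -> cell_rep n d T tau' ->
  tau = act g tau' -> special s T g.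
Proof.
move=> cr cr'; apply: last_special_act; rewrite ?(cell_rep_last cr) ?(cell_rep_last cr') //.
exact: skel_cell_size (cell_rep_skel cr').
Qed.

(** A conjugating $g$ carries $W_{T'}$ to $W_T$, which forces $T = T'$ and then $g \in W_T$; both
    chains are the chosen representative of one $W_T$-orbit. *)
Lemma cell_rep_inj T T' tau tau' : cell_rep n d T tau -> cell_rep n d T' tau' ->
  orb_rep (fun _ => True) tau = orb_rep (fun _ => True) tau' -> T = T' /\ tau = tau'.
Proof.
move=> cr cr' /(orb_rep_eq (subgroup_whole W)) [g [_ e]].
have eT : T = T'.
  apply: (@coset_inj 1%g g); rewrite coset1 -(lact_special g) -(cell_rep_last cr') -last_act.
    by rewrite -e (cell_rep_last cr).
  exact: skel_cell_size (cell_rep_skel cr').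
split=> //; rewrite -eT in cr'; have Tg := cell_rep_act_special cr cr' e.
have [_ _ _ <-] := cr; have [_ _ _ <-] := cr'.
by rewrite e orb_rep_act //; apply: special_subgroup.
Qed.

(** If the top is $w W_T$, translation by $w^{-1}$ makes it $W_T$; then the $W_T$-representative is
    taken. With [cell_rep_inj] this puts the pairs ([T], [tau]) in bijection with the $W$-orbits of
    relative simplices. *)
Lemma skel_cell_rep sigma : skel_cell n d sigma ->
  exists T tau, cell_rep n d T tau /\
    orb_rep (fun _ => True) tau = orb_rep (fun _ => True) sigma.
Proof.
move=> cs; have [w [T [sT cT eL]]] := skel_cell_last cs.
have [g [Tg eg]] := orb_rep_in (act w^-1%g sigma) (special_subgroup T).
exists T, (orb_rep (special s T) (act w^-1%g sigma)); split; last first.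
  by rewrite eg !orb_rep_act.
split=> //; last exact/orb_rep_id/special_subgroup.
apply/(cellP _ _ sT cT); rewrite eg; split; first by do 2!apply: skel_cell_act.
have sz := skel_cell_size cs.
rewrite !last_act ?size_map // eL !lact_coset mulVg mulg1; exact: coset_special.
Qed.

End Rep.
End Cells.

(** * Bredon chains *)

Section FiniteSums.
Variable V : zmodType.

Lemma big_neq0_In (A : Type) (l : seq A) (F : A -> V) :
  \sum_(x <- l) F x != 0 -> exists x, List.In x l /\ F x != 0.
Proof.
elim: l => [|x l IHl]; first by rewrite big_nil eqxx.
rewrite big_cons; have [->|Fx _] := eqVneq (F x) 0; last by exists x; split=> //; left.
by rewrite add0r => /IHl [y [yl Fy]]; exists y; split=> //; right.
Qed.
End FiniteSums.

(** * Maps induced by a Bredon module *)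

Section BredonModule.
Variables (W : groupType) (M : (W -> Prop) -> zmodType).
Variable Mmap : forall K L : W -> Prop, W -> M K -> M L.
Hypothesis Mbredon : is_fin_bredon_module Mmap.

Section Additive.
Variables (K L : W -> Prop) (g : W).
Hypotheses (fK : fin_subgroup K) (fL : fin_subgroup L) (gKL : orbit_mor K L g).

Lemma MmapB x y : Mmap L g (x - y : M K) = Mmap L g x - Mmap L g y.
Proof. by have [MB _ _ _] := Mbredon fK fL fL; apply: MB. Qed.

Lemma Mmap0 : Mmap L g (0 : M K) = 0.
Proof. by rewrite -{1}(subrr 0) MmapB subrr. Qed.

Lemma MmapN x : Mmap L g (- x : M K) = - Mmap L g x.
Proof. by rewrite -[in LHS](sub0r x) MmapB Mmap0 sub0r. Qed.

Lemma MmapD x y : Mmap L g (x + y : M K) = Mmap L g x + Mmap L g y.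
Proof. by rewrite -{1}[y]opprK MmapB MmapN opprK. Qed.

Lemma Mmap_sum (A : Type) (l : seq A) (F : A -> M K) :
  Mmap L g (\sum_(x <- l) F x) = \sum_(x <- l) Mmap L g (F x).
Proof. by rewrite (big_morph _ MmapD Mmap0). Qed.

Lemma Mmap_pif (P : Prop) (x : M K) : Mmap L g (pif P x) = pif P (Mmap L g x).
Proof. by rewrite /pif; case: (excluded_middle_informative P) => ? //; apply: Mmap0. Qed.
End Additive.

Lemma Mmap_eq (K L : W -> Prop) g g' (x : M K) : fin_subgroup K -> fin_subgroup L ->
  orbit_mor K L g -> L (g^-1 * g')%g -> Mmap L g x = Mmap L g' x.
Proof. by move=> fK fL gKL Lg; have [_ MQ _ _] := Mbredon fK fL fL; apply: MQ. Qed.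

Lemma Mmap_comp (K L P : W -> Prop) g h (x : M K) :
  fin_subgroup K -> fin_subgroup L -> fin_subgroup P ->
  orbit_mor K L g -> orbit_mor L P h -> Mmap P h (Mmap L g x) = Mmap P (g * h)%g x.
Proof. by move=> fK fL fP gKL hLP; have [_ _ _ MC] := Mbredon fK fL fP; apply: MC. Qed.

(** The composite is $M(R_{ab})$, and $R_{ab}$ is the identity of $W/K$ because $ab \in K$. *)
Lemma Mmap_cancel (K L : W -> Prop) a b (x : M K) : fin_subgroup K -> fin_subgroup L ->
  orbit_mor K L a -> orbit_mor L K b -> K (a * b)%g -> Mmap K b (Mmap L a x) = x.
Proof.
move=> fK fL aKL bLK Kab; rewrite Mmap_comp //.
have [_ MQ M1 _] := Mbredon fK fK fK.
rewrite -(MQ 1%g) ?invg1 ?mul1g //.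
by move=> k; rewrite invg1 mul1g mulg1.
Qed.

Lemma orbit_mor_comp (K L P : W -> Prop) g h :
  orbit_mor K L g -> orbit_mor L P h -> orbit_mor K P (g * h)%g.
Proof. by move=> gKL hLP k /gKL/hLP; rewrite invgM !mulgA. Qed.

(** The stabilizer of [sigma] also fixes its face, and the transporter conjugates the stabilizer of
    the face into that of [tau]. So the differential uses genuine orbit morphisms. *)
Lemma face_orbit_mor (G : W -> Prop) j sigma tau :
    is_subgroup G -> orb_rep G (face j sigma) = tau ->
  [/\ G (transporter G (face j sigma) tau),
      face j sigma = act (transporter G (face j sigma) tau) tau &
      orbit_mor (stab G sigma) (stab G tau) (transporter G (face j sigma) tau)].
Proof.
move=> sG er; have [_ [GM GV]] := sG.
have [Gt et] : G (transporter G (face j sigma) tau) /\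
    face j sigma = act (transporter G (face j sigma) tau) tau.
  apply: transporterP; have [g [Gg eg]] := orb_rep_in (face j sigma) sG.
  by exists g^-1%g; split; [apply: GV | rewrite -er eg actK].
split=> // k /(@stab_face _ _ j); apply: orbit_mor_stab et k => k Gk _.
by do 2!apply: (GM) => //; apply: GV.
Qed.

(** * Chain groups and the differential *)

Section Chains.
Variable G : W -> Prop.
Variables X A : (W -> Prop) -> Prop.
Implicit Types c : chain_ty G M.

Lemma chain_suppP d c : is_chain X A d c ->
  List.NoDup (chain_supp c) /\ forall sigma, c sigma != 0 -> List.In sigma (chain_supp c).
Proof.
move=> [_ [l cl]]; apply: (epsilon_spec (inhabits [::]) (fun l =>
  List.NoDup l /\ forall sigma, c sigma != 0 -> List.In sigma l)).
by have [l' [nd ll']] := NoDup_cover l; exists l'; split=> // sigma /cl/ll'.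
Qed.

Lemma bredon_bd_chain d c : is_chain X A d (bredon_bd X A Mmap d c).
Proof.
split=> [tau /pif_neq0 [] //|].
exists (List.flat_map (fun sigma => List.map (fun j : 'I_d.+2 => orb_rep G (face j sigma))
  (index_enum 'I_d.+2)) (chain_supp c)) => tau /pif_neq0 [_].
move=> /big_neq0_In [sigma [sc /big_neq0_In [j [_ /pif_neq0 [[_ <-] _]]]]].
apply/List.in_flat_map; exists sigma; split=> //; apply/List.in_map_iff; exists j.
by split=> //; apply/InP; rewrite mem_index_enum.
Qed.

Lemma chain0 d : is_chain X A d (fun sigma => 0 : M (stab G sigma)).
Proof. by split=> [sigma|]; [rewrite eqxx | exists [::] => sigma; rewrite eqxx]. Qed.

Lemma chainD d c1 c2 : is_chain X A d c1 -> is_chain X A d c2 ->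
  is_chain X A d (chain_add c1 c2).
Proof.
move=> [c1X [l1 c1l]] [c2X [l2 c2l]]; split=> [sigma|].
  rewrite /chain_add; have [->|/c1X //] := eqVneq (c1 sigma) 0.
  by rewrite add0r => /c2X.
exists (l1 ++ l2) => sigma; rewrite /chain_add => c12; apply/List.in_app_iff.
have [c10|/c1l] := eqVneq (c1 sigma) 0; last by left.
by right; apply: c2l; rewrite c10 add0r in c12.
Qed.

Hypothesis sG : is_subgroup G.
Hypothesis fin_cell : forall d sigma, rel_cell X A d sigma -> fin_subgroup (stab G sigma).

(** Members of [chain_supp] need not be cells, so finiteness of the stabilizer is inherited from the
    face. *)
Lemma face_fin_stab d j sigma : rel_cell X A d (face j sigma) -> fin_subgroup (stab G sigma).
Proof.
move=> cf; apply: fin_subgroup_sub (fin_cell cf); first exact: stab_subgroup.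
by move=> g; apply: stab_face.
Qed.

Definition bd_summand d (c : chain_ty G M) tau sigma (j : nat) : M (stab G tau) :=
  pif (rel_cell X A d (face j sigma) /\ orb_rep G (face j sigma) = tau)
    (let v := Mmap (stab G tau) (transporter G (face j sigma) tau) (c sigma) in
     if odd j then - v else v).

Lemma bredon_bdE d c tau : bredon_bd X A Mmap d c tau =
  pif (rel_cell X A d tau /\ orb_rep G tau = tau)
    (\sum_(sigma <- chain_supp c) \sum_(j < d.+2) bd_summand d c tau sigma j).
Proof. by []. Qed.

Lemma bd_summand_neq0 d c tau sigma j : fin_subgroup (stab G tau) ->
  bd_summand d c tau sigma j != 0 ->
  [/\ rel_cell X A d (face j sigma), orb_rep G (face j sigma) = tau & c sigma != 0].
Proof.
move=> ft /pif_neq0 [[cf er] /= nz]; split=> //.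
have [_ _ om] := face_orbit_mor sG er.
apply: contra_neq nz => ->; rewrite Mmap0 ?oppr0 ?if_same //.
exact: face_fin_stab cf.
Qed.

Lemma bredon_bd0 d tau : bredon_bd X A Mmap d (fun sigma => 0 : M (stab G sigma)) tau = 0.
Proof.
rewrite bredon_bdE; have [[ct er]|?] := excluded_middle_informative
  (rel_cell X A d tau /\ orb_rep G tau = tau); last by rewrite pif_false.
rewrite pif_true // big1 // => sigma _; rewrite big1 // => j _; apply/eqP.
by apply: contraT => /(bd_summand_neq0 (fin_cell ct)) [_ _]; rewrite eqxx.
Qed.
End Chains.
End BredonModule.

(** * The isomorphism of chain complexes *)

Section Decomposition.
Variables (W : groupType) (N : nat) (s : 'I_N -> W).
Variables (M : (W -> Prop) -> zmodType) (Mmap : forall K L : W -> Prop, W -> M K -> M L).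
Hypothesis generator_special : forall (T : {set 'I_N}) i, special s T (s i) -> i \in T.
Hypothesis Mbredon : is_fin_bredon_module Mmap.
Variable n : nat.

Local Notation whole := (fun _ : W => True).
Local Notation orb := (orb_rep whole).
Local Notation skel_cell := (rel_cell (Sigma_skel s n) (Sigma_skel_prev s n)).
Local Notation cell T := (rel_cell (cox_cell s T) (cox_cell_bd s T)).
Local Notation skel_bd := (bredon_bd (Sigma_skel s n) (Sigma_skel_prev s n) Mmap).
Local Notation cell_bd T := (bredon_bd (cox_cell s T) (cox_cell_bd s T) Mmap).
Local Notation skel_chain := (is_chain (Sigma_skel s n) (Sigma_skel_prev s n)).
Local Notation cell_chain T := (is_chain (cox_cell s T) (cox_cell_bd s T)).

(** The comparison map: the coefficient at the $W$-representative [orb tau] is transported to [tau],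
    which in general is a different point of the same orbit. *)
Definition restrict_chain d (c : chain_ty whole M) : dsum_ty s M := fun T tau =>
  pif (cell_rep s n d T tau)
    (Mmap (stab (special s T) tau) (transporter whole (orb tau) tau) (c (orb tau))).

Lemma act_transporter_orb tau : orb tau = act (transporter whole (orb tau) tau) tau.
Proof.
have [g [_ e]] := orb_rep_in tau (subgroup_whole W).
exact: transporter_wholeP e.
Qed.

Lemma act_orb_transporter tau : tau = act (transporter whole tau (orb tau)) (orb tau).
Proof.
have [g [_ e]] := orb_rep_in tau (subgroup_whole W).
by apply: (@transporter_wholeP _ g^-1%g); rewrite e actK.
Qed.

(** * The coefficient isomorphism at a single generator *)

Section Cell.
Variables (d : nat) (T : {set 'I_N}) (tau : seq (W -> Prop)).
Hypothesis crT : cell_rep s n d T tau.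

Lemma cell_rep_orb_skel : skel_cell d (orb tau).
Proof. by rewrite act_transporter_orb; apply/skel_cell_act/(cell_rep_skel _ crT). Qed.

Lemma fin_stab_orb : fin_subgroup (stab whole (orb tau)).
Proof. exact: skel_cell_stab (subgroup_whole W) cell_rep_orb_skel. Qed.

Lemma fin_stab_cell : fin_subgroup (stab (special s T) tau).
Proof. exact: skel_cell_stab (special_subgroup s T) (cell_rep_skel _ crT). Qed.

(** An element of $W$ fixing [tau] fixes its top $W_T$, hence lies in $W_T$: the stabilizers in $W$
    and in $W_T$ agree. *)
Lemma orbit_mor_to_cell sigma g : sigma = act g tau ->
  orbit_mor (stab whole sigma) (stab (special s T) tau) g.
Proof.
move=> e; apply: orbit_mor_stab (e) => k _; rewrite e => ke.
apply: (cell_rep_act_special _ crT crT) => //.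
by rewrite !actM ke actK.
Qed.

Lemma orbit_mor_from_cell sigma g : tau = act g sigma ->
  orbit_mor (stab (special s T) tau) (stab whole sigma) g.
Proof. exact: orbit_mor_stab. Qed.

(** The two transporters are chosen independently, so they are inverse only up to the stabilizer,
    which acts trivially on coefficients. *)
Lemma Mmap_from_to_cell (x : M (stab whole (orb tau))) :
  Mmap (stab whole (orb tau)) (transporter whole tau (orb tau))
    (Mmap (stab (special s T) tau) (transporter whole (orb tau) tau) x) = x.
Proof.
apply: (Mmap_cancel Mbredon); [exact: fin_stab_orb | exact: fin_stab_cell | | |].
- exact/orbit_mor_to_cell/act_transporter_orb.
- exact/orbit_mor_from_cell/act_orb_transporter.
- by split=> //; rewrite actM -act_orb_transporter -act_transporter_orb.
Qed.

Lemma Mmap_to_from_cell (x : M (stab (special s T) tau)) :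
  Mmap (stab (special s T) tau) (transporter whole (orb tau) tau)
    (Mmap (stab whole (orb tau)) (transporter whole tau (orb tau)) x) = x.
Proof.
have e : act (transporter whole tau (orb tau) * transporter whole (orb tau) tau)%g tau = tau.
  by rewrite actM -act_transporter_orb -act_orb_transporter.
apply: (Mmap_cancel Mbredon); [exact: fin_stab_cell | exact: fin_stab_orb | | |].
- exact/orbit_mor_from_cell/act_orb_transporter.
- exact/orbit_mor_to_cell/act_transporter_orb.
- by split; rewrite ?e //; apply: (cell_rep_act_special _ crT crT).
Qed.

Lemma restrict_chainE c : restrict_chain d c T tau =
  Mmap (stab (special s T) tau) (transporter whole (orb tau) tau) (c (orb tau)).
Proof. by rewrite /restrict_chain pif_true. Qed.

Lemma Mmap_to_cell0 :
  Mmap (stab (special s T) tau) (transporter whole (orb tau) tau)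
    (0 : M (stab whole (orb tau))) = 0.
Proof.
apply: (Mmap0 Mbredon); [exact: fin_stab_orb | exact: fin_stab_cell |].
exact/orbit_mor_to_cell/act_transporter_orb.
Qed.

Lemma restrict_chain_eq0 c : (restrict_chain d c T tau == 0) = (c (orb tau) == 0).
Proof.
rewrite restrict_chainE; apply/eqP/eqP => [e|->]; last exact: Mmap_to_cell0.
rewrite -[LHS]Mmap_from_to_cell e; apply: (Mmap0 Mbredon).
- exact: fin_stab_cell.
- exact: fin_stab_orb.
- exact/orbit_mor_from_cell/act_orb_transporter.
Qed.
End Cell.

(** * Compatibility with the differentials *)

Lemma restrict_chain_out d c T tau :
  ~ cell_rep s n d T tau -> restrict_chain d c T tau = 0 :> M (stab (special s T) tau).
Proof. exact: pif_false. Qed.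

(** Inverse of the bijection sending ([T], [tau]) to the representative of its $W$-orbit. *)
Definition cell_of_orbit d sigma : {set 'I_N} * seq (W -> Prop) :=
  epsilon (inhabits (set0, [::])) (fun p => cell_rep s n d p.1 p.2 /\ orb p.2 = sigma).

Lemma cell_of_orbitP d sigma : skel_cell d sigma -> orb sigma = sigma ->
  let p := cell_of_orbit d sigma in cell_rep s n d p.1 p.2 /\ orb p.2 = sigma.
Proof.
move=> cs er; apply: (epsilon_spec _ (fun p => cell_rep s n d p.1 p.2 /\ orb p.2 = sigma)).
have [T [tau [cr e]]] := skel_cell_rep generator_special cs.
by exists (T, tau); rewrite e.
Qed.

Lemma cell_of_orbit_rep d T tau : cell_rep s n d T tau -> cell_of_orbit d (orb tau) = (T, tau).
Proof.
move=> cr; have er := orb_rep_id tau (subgroup_whole W).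
have [cr' /(cell_rep_inj generator_special cr' cr)] := cell_of_orbitP (cell_rep_orb_skel cr) er.
by case: (cell_of_orbit _ _) => T' tau' /= [-> ->].
Qed.

Lemma restrict_chain_chain d c T :
  skel_chain d c -> cell_chain T d (restrict_chain d c T : chain_ty (special s T) M).
Proof.
move=> [cX [l cl]]; split=> [tau /pif_neq0 [[] //]|].
exists (List.map (fun sigma => (cell_of_orbit d sigma).2) l) => tau nz.
have [cr _] := pif_neq0 nz; rewrite restrict_chain_eq0 // in nz.
apply/List.in_map_iff; exists (orb tau); split; last exact: cl.
by rewrite (cell_of_orbit_rep cr).
Qed.

(** The nonzero summands of the two differentials correspond under [orb], face by face, and
    corresponding coefficients agree after transport along [t']. *)
Lemma restrict_chain_bd d c T tau' : skel_chain d.+1 c -> spherical s T -> #|T| = n ->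
  cell_bd T d (restrict_chain d.+1 c T : chain_ty (special s T) M) tau'
    = restrict_chain d (skel_bd d c) T tau'.
Proof.
move=> cc sT cT.
have [cr'|ncr'] := excluded_middle_informative (cell_rep s n d T tau'); last first.
  rewrite restrict_chain_out // bredon_bdE pif_false // => -[ct er].
  exact: ncr'.
rewrite restrict_chainE //; have [_ _ ct' er'] := cr'.
set rho' := orb tau'; set t' := transporter whole rho' tau'.
have cc' : cell_chain T d.+1 (restrict_chain d.+1 c T : chain_ty (special s T) M).
  exact: restrict_chain_chain.
rewrite !bredon_bdE pif_true // pif_true; last first.
  by split; [apply: cell_rep_orb_skel cr' | apply/orb_rep_id/subgroup_whole].
have frho' : fin_subgroup (stab whole rho') := fin_stab_orb cr'.
have ftau' : fin_subgroup (stab (special s T) tau') := fin_stab_cell cr'.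
have et' : rho' = act t' tau' := act_transporter_orb tau'.
have mt' : orbit_mor (stab whole rho') (stab (special s T) tau') t'.
  exact: (orbit_mor_to_cell cr').
rewrite (Mmap_sum Mbredon) //.
have skel_fin e sigma : skel_cell e sigma -> fin_subgroup (stab whole sigma).
  exact: skel_cell_stab (subgroup_whole W).
have cell_fin e sigma : cell T e sigma -> fin_subgroup (stab (special s T) sigma).
  by move=> /(cellP generator_special _ _ sT cT) [/(skel_cell_stab (special_subgroup s T))].
have orbE tau : cell_rep s n d.+1 T tau ->
    \sum_(j < d.+2) bd_summand Mmap (cox_cell s T) (cox_cell_bd s T) d
        (restrict_chain d.+1 c T : chain_ty (special s T) M) tau' tau j
    = Mmap (stab (special s T) tau') t'
        (\sum_(j < d.+2) bd_summand Mmap (Sigma_skel s n) (Sigma_skel_prev s n) d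
           c rho' (orb tau) j).
  move=> cr; rewrite (Mmap_sum Mbredon) //; apply: eq_bigr => j _.
  set b := transporter whole (orb tau) tau.
  have eb : orb tau = act b tau := act_transporter_orb tau.
  have cs := cell_rep_skel generator_special cr.
  rewrite /bd_summand (Mmap_pif Mbredon) //.
  have faceE : face j (orb tau) = act b (face j tau) by rewrite eb face_act.
  (* First, the [j]-th face is a relative cell represented by [tau'] over $W_T$ exactly when its
     translate is one represented by [rho'] over $W$. *)
  apply: eq_pif.
    rewrite (cellP generator_special _ _ sT cT) faceE; split=> [[[cf lf] er]|[cf er]].
      split; first exact: skel_cell_act.
      rewrite orb_rep_act //; move: er.
      have [g [_ ->]] := orb_rep_in (face j tau) (special_subgroup s T).
      by move=> eg; rewrite /rho' -eg orb_rep_act.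
    have cf' : skel_cell d (face j tau).
      by rewrite -[face j tau](actK b); apply: skel_cell_act.
    have lf : last (fun _ => False) (face j tau) = special s T.
      rewrite (skel_cell_face_last generator_special cs cf').
      by rewrite (cell_rep_last generator_special cr).
    (* The face kept its top $W_T$, so the element [h] of $W$ carrying [tau'] to it lies in
       $W_T$. *)
    split=> //; move: er; rewrite orb_rep_act // => /(orb_rep_eq (subgroup_whole W)) [h [_ eh]].
    rewrite eh orb_rep_act //; first exact: special_subgroup.
    apply: (last_special_act _ lf (cell_rep_last generator_special cr') eh).
    exact: skel_cell_size (cell_rep_skel generator_special cr').
  move=> [cf er].
  have [Ta ea ma] := face_orbit_mor (special_subgroup s T) er.
  set a := transporter (special s T) _ _ in Ta ea ma *.
  have er2 : orb (face j (orb tau)) = rho'.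
    by rewrite faceE orb_rep_act // ea orb_rep_act.
  have [_ ee me] := face_orbit_mor (subgroup_whole W) er2.
  set e := transporter whole _ _ in ee me *.
  have ft := fin_stab_cell cr; have ftorb := fin_stab_orb cr.
  have mb : orbit_mor (stab whole (orb tau)) (stab (special s T) tau) b.
    exact: (orbit_mor_to_cell cr).
  (* Both [b * a] and [e * t'] carry [tau'] to the same face of [orb tau]. They differ by an element
     of the stabilizer of [tau'], so they induce the same map. *)
  suff eqM : Mmap (stab (special s T) tau') a (restrict_chain d.+1 c T tau)
      = Mmap (stab (special s T) tau') t' (Mmap (stab whole rho') e (c (orb tau))).
    by rewrite /= eqM; case: (odd j); rewrite ?(MmapN Mbredon).
  rewrite restrict_chainE // -/b !(Mmap_comp Mbredon) //.
  apply: (Mmap_eq Mbredon) => //; first exact: orbit_mor_comp mb ma.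
  have eqT : tau' = act ((b * a)^-1 * (e * t'))%g tau'.
    by rewrite !actM -et' -ee faceE ea -(actM b a) actK.
  by split; [apply: (cell_rep_act_special generator_special cr' cr') eqT | rewrite -eqT].
have [nd1 in1] := chain_suppP cc'; have [nd2 in2] := chain_suppP cc.
have cr_F tau : \sum_(j < d.+2) bd_summand Mmap (cox_cell s T) (cox_cell_bd s T) d
    (restrict_chain d.+1 c T : chain_ty (special s T) M) tau' tau j != 0 ->
    cell_rep s n d.+1 T tau.
  move=> /big_neq0_In [j [_ /(bd_summand_neq0 Mbredon (special_subgroup s T) cell_fin ftau')]].
  by move=> [_ _ /pif_neq0 []].
apply: (big_NoDup_reindex (phi := orb_rep whole)) => //.
- move=> tau _ nz; have cr := cr_F _ nz; rewrite orbE // in nz *; split=> //.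
  apply: in2; have : \sum_(j < d.+2) bd_summand Mmap (Sigma_skel s n) (Sigma_skel_prev s n) d
           c rho' (orb tau) j != 0.
    by apply: contra_neq nz => ->; rewrite (Mmap0 Mbredon).
  by move=> /big_neq0_In [j [_ /(bd_summand_neq0 Mbredon (subgroup_whole W) skel_fin frho') []]].
- by move=> tau1 tau2 /cr_F cr1 /cr_F cr2 /(cell_rep_inj generator_special cr1 cr2) [].
move=> sigma _ nz.
have : \sum_(j < d.+2) bd_summand Mmap (Sigma_skel s n) (Sigma_skel_prev s n) d
         c rho' sigma j != 0.
  by apply: contra_neq nz => ->; rewrite (Mmap0 Mbredon).
move=> /big_neq0_In [j [_ /(bd_summand_neq0 Mbredon (subgroup_whole W) skel_fin frho')]].
move=> [cf er cnz]; have [cs ers] := cc.1 _ cnz.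
have [T1 [tau [cr eo]]] := skel_cell_rep generator_special cs.
rewrite ers in eo.
(* A face of [sigma] shares its top and is $W$-conjugate to [tau'], whose top is $W_T$; hence a
   translate of $W_{T_1}$ equals a translate of $W_T$. *)
have eT : T1 = T.
  have [h [_ eh]] := orb_rep_eq (subgroup_whole W) (etrans er (erefl (orb tau'))).
  have [g [_ eg]] := orb_rep_in tau (subgroup_whole W); rewrite eo in eg.
  have := cell_rep_last generator_special cr.
  have := skel_cell_face_last generator_special cs cf.
  rewrite eh eg !last_act ?(skel_cell_size (cell_rep_skel generator_special cr))
    ?(skel_cell_size (cell_rep_skel generator_special cr')) //.
  rewrite (cell_rep_last generator_special cr) (cell_rep_last generator_special cr').
  by rewrite !lact_special => /(coset_inj generator_special).
subst T1; exists tau; split=> //; last by rewrite orbE // eo.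
by apply: in1; rewrite restrict_chain_eq0 // eo.
Qed.

Lemma restrict_chain_zero d c T tau : (forall sigma, c sigma = 0) ->
  restrict_chain d c T tau = 0 :> M (stab (special s T) tau).
Proof.
move=> c0; have [cr|] := excluded_middle_informative (cell_rep s n d T tau).
  by apply/eqP; rewrite restrict_chain_eq0 // c0.
exact: restrict_chain_out.
Qed.

Lemma restrict_chainD d c1 c2 :
  restrict_chain d (chain_add c1 c2) = dsum_add (restrict_chain d c1) (restrict_chain d c2).
Proof.
apply: functional_extensionality_dep => T; apply: functional_extensionality_dep => tau.
rewrite /dsum_add /chain_add.
have [cr|ncr] := excluded_middle_informative (cell_rep s n d T tau); last first.
  by rewrite !restrict_chain_out // addr0.
rewrite !restrict_chainE // (MmapD Mbredon) //.
- exact: fin_stab_orb cr.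
- exact: fin_stab_cell cr.
- exact/(orbit_mor_to_cell cr)/act_transporter_orb.
Qed.

(** * The inverse map on chains *)

Definition lift_chain d (b : dsum_ty s M) : chain_ty whole M := fun sigma =>
  let p := cell_of_orbit d sigma in
  pif (skel_cell d sigma /\ orb sigma = sigma)
    (Mmap (stab whole sigma) (transporter whole p.2 sigma)
       (b p.1 p.2 : M (stab (special s p.1) p.2))).

Lemma lift_chainE d b T tau : cell_rep s n d T tau ->
  lift_chain d b (orb tau) =
    Mmap (stab whole (orb tau)) (transporter whole tau (orb tau))
      (b T tau : M (stab (special s T) tau)).
Proof.
move=> cr; rewrite /lift_chain pif_true ?(cell_of_orbit_rep cr) //.
by split; [apply: cell_rep_orb_skel cr | apply/orb_rep_id/subgroup_whole].
Qed.

Lemma skel_chain_orbit d (c : chain_ty whole M) sigma : skel_chain d c -> c sigma != 0 ->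
  exists T tau, cell_rep s n d T tau /\ orb tau = sigma.
Proof.
move=> [cX _] /cX [cs er]; have [T [tau [cr e]]] := skel_cell_rep generator_special cs.
by exists T, tau; rewrite e.
Qed.

Definition dsum_chain d (b : dsum_ty s M) : Prop :=
  dsum_pred n (fun T => @is_chain W (special s T) (cox_cell s T) (cox_cell_bd s T) M d) b.

Lemma dsum_chain_neq0 d b T tau : dsum_chain d b -> b T tau != 0 -> cell_rep s n d T tau.
Proof.
move=> bc nz; have [bT nbT] := bc T.
have [sT|nsT] := excluded_middle_informative (spherical s T /\ #|T| = n).
  by have [/(_ tau nz) [ct er] _] := bT sT; case: sT => sT cT; split.
by rewrite nbT ?eqxx in nz.
Qed.

Lemma restrict_dsum_chain d c : skel_chain d c -> dsum_chain d (restrict_chain d c).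
Proof.
move=> cc T; split=> [[sT cT]|nsT sigma]; first exact: restrict_chain_chain.
by apply: restrict_chain_out => -[sT cT _ _]; apply: nsT.
Qed.

(** The support is finite: it lies in the union, over the finitely many $T$, of the images of the
    supports of the components. *)
Lemma lift_chain_chain d b : dsum_chain d b -> skel_chain d (lift_chain d b).
Proof.
move=> bc; split=> [sigma /pif_neq0 [] //|].
exists (List.flat_map (fun T => List.map orb (chain_supp (b T))) (index_enum {set 'I_N})).
move=> sigma nz; have [[cs er] _] := pif_neq0 nz.
have [T [tau [cr0 e0]]] := skel_cell_rep generator_special cs.
rewrite er in e0; rewrite -e0 (lift_chainE b cr0) in nz *.
have bnz : b T tau != 0.
  apply: contra_neq nz => ->; apply: (Mmap0 Mbredon).
  - exact: fin_stab_cell cr0.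
  - exact: fin_stab_orb cr0.
  - exact/orbit_mor_from_cell/act_orb_transporter.
have [sT cT _ _] := cr0; have [_ bin] := chain_suppP ((bc T).1 (conj sT cT)).
apply/List.in_flat_map; exists T; split; first by apply/InP; rewrite mem_index_enum.
by apply/List.in_map_iff; exists tau; split=> //; apply: bin.
Qed.

Lemma lift_chainK d b : dsum_chain d b -> restrict_chain d (lift_chain d b) = b.
Proof.
move=> bc; apply: functional_extensionality_dep => T.
apply: functional_extensionality_dep => tau.
have [cr|ncr] := excluded_middle_informative (cell_rep s n d T tau).
  by rewrite restrict_chainE // (lift_chainE b cr) (Mmap_to_from_cell cr).
rewrite restrict_chain_out //; apply/esym/eqP; apply: contraT => nz.
by case: ncr; apply: dsum_chain_neq0 nz.
Qed.

Lemma restrict_chainK d c : skel_chain d c -> lift_chain d (restrict_chain d c) = c.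
Proof.
move=> cc; apply: functional_extensionality_dep => sigma.
have [[cs er]|ncs] := excluded_middle_informative (skel_cell d sigma /\ orb sigma = sigma).
  have [T [tau [cr e]]] := skel_cell_rep generator_special cs.
  rewrite er in e; rewrite -e (lift_chainE _ cr) restrict_chainE //.
  exact: Mmap_from_to_cell cr _.
rewrite [LHS]pif_false //; apply/esym/eqP; apply: contraT => nz.
by case: ncs; apply: cc.1 nz.
Qed.

(** * Passage to homology *)

Local Notation skel_cycle := (bredon_cycle (Sigma_skel s n) (Sigma_skel_prev s n) Mmap).
Local Notation skel_boundary := (bredon_boundary (Sigma_skel s n) (Sigma_skel_prev s n) Mmap).
Local Notation dsum_cycle i := (dsum_pred n (fun T =>
  bredon_cycle (cox_cell s T) (cox_cell_bd s T) (@restr_map W N s T M Mmap) i)).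
Local Notation dsum_boundary i := (dsum_pred n (fun T =>
  bredon_boundary (cox_cell s T) (cox_cell_bd s T) (@restr_map W N s T M Mmap) i)).

Lemma skel_cycle_chain i (c : chain_ty whole M) : skel_cycle i c -> skel_chain i c.
Proof. by case. Qed.

Lemma dsum_cycle_chain i b : dsum_cycle i b -> dsum_chain i b.
Proof. by move=> bc T; have [bT nbT] := bc T; split=> // /bT []. Qed.

Lemma restrict_cycle i (c : chain_ty whole M) : skel_cycle i c -> dsum_cycle i (restrict_chain i c).
Proof.
move=> [cc c0] T; have [rT nrT] := restrict_dsum_chain cc T; split=> // -[sT cT].
split; first exact: rT.
case: i cc c0 {rT nrT} => // k cc c0 tau.
by rewrite [LHS]restrict_chain_bd // restrict_chain_zero.
Qed.

(** Restriction detects nonzero values and commutes with the differential, so the boundary of the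
    lift is tested on [b] itself. *)
Lemma lift_cycle i b : dsum_cycle i b -> skel_cycle i (lift_chain i b).
Proof.
move=> bc; have cb := dsum_cycle_chain bc; have cl := lift_chain_chain cb; split=> //.
case: i bc cb cl => // k bc cb cl.
have cbd : skel_chain k (skel_bd k (lift_chain k.+1 b)) := bredon_bd_chain _ _ _ _ _.
move=> sigma; apply/eqP; apply: contraT => nz.
have [T [tau [cr e]]] := skel_chain_orbit cbd nz.
move: nz; rewrite -e -(restrict_chain_eq0 cr); have [sT cT _ _] := cr.
rewrite -restrict_chain_bd // lift_chainK //.
by have [_ ->] := (bc T).1 (conj sT cT); rewrite eqxx.
Qed.

Lemma restrict_boundary i (c : chain_ty whole M) :
  skel_boundary i c -> dsum_boundary i (restrict_chain i c).
Proof.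
move=> [b [cb ec]] T.
have {ec}-> : c = skel_bd i b by apply: functional_extensionality_dep.
split=> [[sT cT]|nsT tau].
  exists (restrict_chain i.+1 b T); split; first exact: restrict_chain_chain.
  by move=> tau; rewrite -[LHS]restrict_chain_bd.
by apply: restrict_chain_out => -[sT cT _ _]; apply: nsT.
Qed.

Lemma lift_boundary i z : dsum_boundary i z -> skel_boundary i (lift_chain i z).
Proof.
move=> bz.
(* A bounding chain is chosen for each spherical $T$ of rank $n$, and zero for every other $T$; the
   family is then lifted. *)
have bP T : exists b : chain_ty (special s T) M,
    ((spherical s T /\ #|T| = n) -> cell_chain T i.+1 b /\
        forall tau, z T tau = cell_bd T i b tau) /\
    (~ (spherical s T /\ #|T| = n) -> forall tau, b tau = 0).
  have [sT|nsT] := excluded_middle_informative (spherical s T /\ #|T| = n).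
    by have [b [cb eb]] := (bz T).1 sT; exists b.
  by exists (fun=> 0).
pose b : dsum_ty s M := fun T => sval (cid (bP T)).
have bE T := svalP (cid (bP T)).
have cb : dsum_chain i.+1 b.
  by move=> T; split=> [/(bE T).1 []|/(bE T).2].
exists (lift_chain i.+1 b); split; first exact: lift_chain_chain.
have cbd : skel_chain i (skel_bd i (lift_chain i.+1 b)) := bredon_bd_chain _ _ _ _ _.
move=> sigma; rewrite -(restrict_chainK cbd).
congr (lift_chain i _ sigma).
apply: functional_extensionality_dep => T; apply: functional_extensionality_dep => tau.
have [[sT cT]|nsT] := excluded_middle_informative (spherical s T /\ #|T| = n).
  rewrite -[RHS]restrict_chain_bd ?lift_chain_chain //; last exact: lift_chain_chain.
  by rewrite lift_chainK //; have [_ ->] := (bE T).1 (conj sT cT).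
rewrite [RHS]restrict_chain_out; first by apply: (bz T).2.
by move=> [sT cT _ _]; apply: nsT.
Qed.

Lemma lift_chainD d b1 b2 : dsum_chain d b1 -> dsum_chain d b2 ->
  lift_chain d (dsum_add b1 b2) = chain_add (lift_chain d b1) (lift_chain d b2).
Proof.
move=> c1 c2; rewrite -{1}(lift_chainK c1) -{1}(lift_chainK c2) -restrict_chainD.
by rewrite restrict_chainK //; apply: chainD; apply: lift_chain_chain.
Qed.

(** The homomorphism and inverse laws of [subquot_iso] hold here already for chains, so each
    difference to be bounded has this form. *)
Lemma skel_boundary0 i (c : chain_ty whole M) : skel_boundary i (chain_add c (chain_opp c)).
Proof.
exists (fun=> 0); split=> [|tau]; first exact: chain0.
rewrite bredon_bd0 // => [|d sigma]; first by rewrite /chain_add subrr.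
exact: skel_cell_stab (subgroup_whole W).
Qed.

Lemma dsum_boundary0 i b : dsum_boundary i (dsum_add b (dsum_opp b)).
Proof.
move=> T; split=> [[sT cT]|_ sigma]; last first.
  by rewrite /dsum_add /dsum_opp /chain_add /chain_opp subrr.
exists (fun=> 0); split=> [|tau]; first exact: chain0.
rewrite [RHS](bredon_bd0 Mbredon (special_subgroup s T)) => [|d sigma].
  by rewrite /dsum_add /dsum_opp /chain_add /chain_opp subrr.
by move=> /(cellP generator_special _ _ sT cT) [/(skel_cell_stab (special_subgroup s T))].
Qed.

Lemma subquot_iso_skel i : subquot_iso (@chain_add W whole M) (@chain_opp W whole M)
  (@dsum_add W N s M) (@dsum_opp W N s M)
  (skel_cycle i) (skel_boundary i) (dsum_cycle i) (dsum_boundary i).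
Proof.
exists (restrict_chain i), (lift_chain i); split; split.
- exact: restrict_cycle.
- exact: lift_cycle.
- exact: restrict_boundary.
- exact: lift_boundary.
- by move=> z1 z2 _ _; rewrite restrict_chainD; apply: dsum_boundary0.
- move=> z1 z2 /dsum_cycle_chain c1 /dsum_cycle_chain c2.
  by rewrite lift_chainD //; apply: skel_boundary0.
- by move=> z /skel_cycle_chain cz; rewrite restrict_chainK //; apply: skel_boundary0.
- by move=> z /dsum_cycle_chain cz; rewrite lift_chainK //; apply: dsum_boundary0.
Qed.

End Decomposition.

Theorem theorem5p1 (W : groupType) (N : nat) (m : 'I_N -> 'I_N -> nat) (s : 'I_N -> W)
  (M : (W -> Prop) -> zmodType) (Mmap : forall K L : W -> Prop, W -> M K -> M L) :
  is_coxeter_system m s ->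
  is_fin_bredon_module Mmap ->
  forall n i : nat,
  subquot_iso
    (@chain_add W (fun _ => True) M) (@chain_opp W (fun _ => True) M)
    (@dsum_add W N s M) (@dsum_opp W N s M)
    (bredon_cycle (Sigma_skel s n) (Sigma_skel_prev s n) Mmap i)
    (bredon_boundary (Sigma_skel s n) (Sigma_skel_prev s n) Mmap i)
    (dsum_pred n (fun T => bredon_cycle (cox_cell s T) (cox_cell_bd s T)
                              (@restr_map W N s T M Mmap) i))
    (dsum_pred n (fun T => bredon_boundary (cox_cell s T) (cox_cell_bd s T)
                              (@restr_map W N s T M Mmap) i)).
Proof.
move=> cox Mbredon n i; apply: subquot_iso_skel => // T j.
exact: coxeter_generator_special cox.
Qed.
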